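(* Let $f:\mathbb{R}^n\to\mathbb{R}$ be continuous and bounded, and assume that $f$ attains its minimum. Let $\underline f=\min_{\mathbb{R}^n}f$ and $\mathfrak{M}=\{x: f(x)=\underline f\}\ne\emptyset$. Let $u(x,t)$ be the value function defined in the context, i.e. the viscosity solution of $\partial_tu+\frac12|D_xu|^2=f(x)$ in $\mathbb{R}^n\times(0,+\infty)$, $u(x,0)=0$. Then, as $t\to+\infty$, $$\frac{u(x,t)}{t}\to\underline f\quad\text{and}\quad u(x,t)-\underline f\,t\to v(x)\qquad\text{locally uniformly in }\mathbb{R}^n,$$ where $v$ is the viscosity solution of $\underline f+\frac12|Dv(x)|^2=f(x)$ in $\mathbb{R}^n$ specified in the context. If in addition $f$ is Lipschitz continuous and $C_2$-semiconcave for some constant $C_2$, then $D_xu(x,t)\to Dv(x)$ for a.e. $x\in\mathbb{R}^n$ as $t\to+\infty$.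
   Context: For $x\in\mathbb{R}^n$, $t\geq0$, $$u(x,t)=\inf_\alpha\int_0^t\Big(\tfrac12|\alpha_s|^2+f(x(s))\Big)ds,\qquad \dot x(s)=\alpha_s,\ x(0)=x,$$ the infimum being over measurable controls $\alpha:[0,+\infty)\to\mathbb{R}^n$ (locally integrable, so that the trajectory is defined). The function $v$: under the stated assumptions (A) on $f$ (continuous, bounded, minimum attained), for $\lambda>0$ let $u_\lambda(x)=\inf_\alpha\int_0^{+\infty}\big(\frac12|\alpha_t|^2+f(x(t))\big)e^{-\lambda t}dt$ with the same dynamics. Then $v(x)=\lim_{\lambda\to0^+}\big(u_\lambda(x)-\underline f\lambda^{-1}\big)$ (locally uniform limit); $v$ is a Lipschitz continuous viscosity solution of $\underline f+\frac12|Dv|^2=f$ in $\mathbb{R}^n$, $v\ge0$, $v=0$ on $\mathfrak{M}$, and $v$ is the unique viscosity solution of this equation in $\mathbb{R}^n\setminus\mathfrak{M}$ that vanishes on $\partial\mathfrak{M}$ and is bounded from below. A function $g:\mathbb{R}^n\to\mathbb{R}$ is $C$-semiconcave if it is continuous and $g(x+h)-2g(x)+g(x-h)\le C|h|^2$ for all $x,h\in\mathbb{R}^n$ (i.e. $D^2_{\xi\xi}g\le C$ for all unit vectors $\xi$, in the weak sense). *)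

(* Defs.v *)
From HB Require Import structures.
From mathcomp Require Import all_boot all_order all_algebra.
From mathcomp Require Import all_classical all_reals all_analysis.

Set Implicit Arguments.
Unset Strict Implicit.
Unset Printing Implicit Defensive.

Import Order.TTheory GRing.Theory Num.Theory.
Import numFieldNormedType.Exports.

Local Open Scope classical_set_scope.
Local Open Scope ring_scope.

(* The norm that MathComp-Analysis puts on 'rV[R]_n is the sup norm.  It is
   used below only through its topology (continuity, compactness, convergence,
   differentiability) and through [lipschitz], none of which depends on the
   choice of norm; |.|^2 in the costs, in the Hamiltonian and in
   semiconcavity is the Euclidean one. *)
Definition enorm2 (R : realType) (n : nat) (x : 'rV[R]_n) : R :=
  \sum_(i < n) x ord0 i ^+ 2.

Definition admissible (R : realType) (n : nat) : set (R -> 'rV[R]_n) :=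
  [set alpha | forall (i : 'I_n) (T : R), 0 <= T ->
     lebesgue_measure.-integrable `[0, T] (fun s => (alpha s ord0 i)%:E)].

(* The absolutely continuous solution of x' = alpha, x(0) = x. *)
Definition trajectory (R : realType) (n : nat) (x : 'rV[R]_n)
    (alpha : R -> 'rV[R]_n) (s : R) : 'rV[R]_n :=
  x + \row_(i < n) \int[lebesgue_measure]_(r in `[0, s]) alpha r ord0 i.

Definition lagrangian (R : realType) (n : nat) (f : 'rV[R]_n -> R)
    (x : 'rV[R]_n) (alpha : R -> 'rV[R]_n) (s : R) : R :=
  enorm2 (alpha s) / 2 + f (trajectory x alpha s).

(* Costs are extended-real valued: a locally integrable control may have
   infinite energy. *)
Definition finite_horizon_cost (R : realType) (n : nat) (f : 'rV[R]_n -> R)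
    (x : 'rV[R]_n) (t : R) (alpha : R -> 'rV[R]_n) : \bar R :=
  (\int[lebesgue_measure]_(s in `[0%R, t]) (lagrangian f x alpha s)%:E)%E.

Definition discounted_cost (R : realType) (n : nat) (f : 'rV[R]_n -> R)
    (lambda : R) (x : 'rV[R]_n) (alpha : R -> 'rV[R]_n) : \bar R :=
  (\int[lebesgue_measure]_(s in `[0%R, +oo[)
     (lagrangian f x alpha s * expR (- (lambda * s)))%:E)%E.

(* For bounded f the infima below are finite (take alpha = 0 for the upper
   bound), so that [fine] loses no information. *)
Definition value (R : realType) (n : nat) (f : 'rV[R]_n -> R)
    (x : 'rV[R]_n) (t : R) : R :=
  fine (ereal_inf (finite_horizon_cost f x t @` @admissible R n)).

Definition discounted_value (R : realType) (n : nat) (f : 'rV[R]_n -> R)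
    (lambda : R) (x : 'rV[R]_n) : R :=
  fine (ereal_inf (discounted_cost f lambda x @` @admissible R n)).

Definition fmin (R : realType) (n : nat) (f : 'rV[R]_n -> R) : R :=
  inf (range f).

Definition ergodic_limit (R : realType) (n : nat) (f : 'rV[R]_n -> R)
    (x : 'rV[R]_n) : R :=
  lim ((discounted_value f lambda x - fmin f / lambda) @[lambda --> 0^'+]).

Definition grad (R : realType) (n : nat) (g : 'rV[R]_n -> R) (x : 'rV[R]_n) :
    'rV[R]_n :=
  \row_(i < n) 'D_(delta_mx ord0 i) g x.

Definition C1 (R : realType) (n : nat) (phi : 'rV[R]_n -> R) : Prop :=
  (forall x, differentiable phi x) /\ continuous (grad phi).

Definition viscosity_subsolution (R : realType) (n : nat)
    (H : 'rV[R]_n -> 'rV[R]_n -> R) (w : 'rV[R]_n -> R) : Prop :=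
  forall (phi : 'rV[R]_n -> R) (x : 'rV[R]_n), C1 phi ->
    (\forall y \near x, w y - phi y <= w x - phi x) ->
    H x (grad phi x) <= 0.

Definition viscosity_supersolution (R : realType) (n : nat)
    (H : 'rV[R]_n -> 'rV[R]_n -> R) (w : 'rV[R]_n -> R) : Prop :=
  forall (phi : 'rV[R]_n -> R) (x : 'rV[R]_n), C1 phi ->
    (\forall y \near x, w x - phi x <= w y - phi y) ->
    0 <= H x (grad phi x).

(* Viscosity solutions of H(x, Dw) = 0 in the whole space. *)
Definition viscosity_solution (R : realType) (n : nat)
    (H : 'rV[R]_n -> 'rV[R]_n -> R) (w : 'rV[R]_n -> R) : Prop :=
  [/\ continuous w, viscosity_subsolution H w & viscosity_supersolution H w].

Definition semiconcave (R : realType) (n : nat) (C : R) (g : 'rV[R]_n -> R) :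
    Prop :=
  continuous g /\
  forall x h, g (x + h) - 2 * g x + g (x - h) <= C * enorm2 h.

(* Lebesgue-null subsets of R^n, n >= 1: coverable by countably many closed
   boxes of arbitrarily small total volume. *)
Definition lebesgue_null (R : realType) (n : nat) (N : set 'rV[R]_n) : Prop :=
  forall e : R, 0 < e -> exists a b : nat -> 'rV[R]_n,
    [/\ forall k i, a k ord0 i <= b k ord0 i,
        N `<=` \bigcup_k
          [set x | forall i, a k ord0 i <= x ord0 i <= b k ord0 i] &
        (\sum_(0 <= k <oo) (\prod_(i < n) (b k ord0 i - a k ord0 i))%:E
           <= e%:E)%E].

Definition almost_everywhere_Rn (R : realType) (n : nat)
    (P : 'rV[R]_n -> Prop) : Prop :=
  lebesgue_null [set x | ~ P x].

(* Main.v *)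
Require Import Defs.
From HB Require Import structures.
From mathcomp Require Import all_boot all_order all_algebra.
From mathcomp Require Import all_classical all_reals all_analysis.
From mathcomp Require Import measurable_realfun.
From mathcomp Require Import ring lra.

Set Implicit Arguments.
Unset Strict Implicit.
Unset Printing Implicit Defensive.

Import Order.TTheory GRing.Theory Num.Theory.
Import numFieldNormedType.Exports.

Local Open Scope classical_set_scope.
Local Open Scope ring_scope.

(* After subtracting the minimum one may assume f >= 0 = f(x0).  Then u(x, t)
   is nondecreasing in t, bounded (go to x0 in unit time) and Lipschitz in x
   uniformly in t (go straight from x to y at unit speed), so it increases
   locally uniformly to some v.  Truncating controls at time T gives
     e^(-lambda T) u(x, T) <= u_lambda(x) <= u(x, T) + |f|_oo e^(-lambda T) / lambda,
   so v is also the limit of the discounted problems, and no compactness of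
   controls is needed.  Both halves of dynamic programming pass to the limit
   and make v a viscosity solution.

   Shifting the starting point by h along x(s) + e^(-s) h shows that u(., t) is
   semiconcave in x with a constant independent of t.  Hence u(., t) and v are,
   up to a fixed quadratic, concave and Lipschitz: they are differentiable
   almost everywhere, and pointwise convergence of convex functions forces
   convergence of gradients at every point of differentiability. *)

(** * Integrals over intervals *)

Section integrals.
Context {R : realType}.
Notation mu := (@lebesgue_measure R).

(** Admissible controls may have infinite energy, so costs are split and compared as integrals of
    nonnegative functions; the minimum of f, of either sign, is added back at the end by an
    additivity lemma that tolerates infinite integrals. In dynamic programming, upper bounds test a
    constant velocity followed by an almost optimal control, and lower bounds retain from an almost
    optimal control only its end point y and the energy |y - x|^2 / (2 s) needed to reach it.

    Differentiability almost everywhere is derived from box coverings, the form in which null sets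
    are given. A convex function fails to be differentiable at x only if, along some coordinate axis
    and for some eps > 0, its second difference at every scale r is at least eps r. Second
    differences along a line telescope, so few cells of a fine grid contain such points.

    The null set off which D_x u(., t) exists depends on t, and an uncountable union of such sets is
    not known to be null; convergence is therefore taken along the times at which the gradient
    exists. *)

Lemma lebesgue_measure_shift (s : R) (A : set (measurableTypeR R)) : measurable A ->
  pushforward mu ((fun r => r + s) : measurableTypeR R -> measurableTypeR R) A = mu A.
Proof.
move=> mA; apply/esym.
apply: (@lebesgue_measure_unique R
  (pushforward mu ((fun r => r + s) : measurableTypeR R -> measurableTypeR R))) => //=.
  exact: measurable_funD.
move=> ms _ [[a b]] _ <-.
rewrite /pushforward.
have -> : (fun r => r + s) @^-1` `]a, b] = `]a - s, b - s]%classic.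
  by apply/seteqP; split => r /=; rewrite !in_itv /= lterBDr lerBrDr.
by rewrite !lebesgue_measure_itv/= !lte_fin ltrD2r -!EFinD opprD addrACA subrr addr0.
Qed.

Lemma ge0_integral_shift (g : R -> \bar R) (s a b : R) :
  measurable_fun `[a, b] g -> (forall r, r \in `[a, b] -> (0 <= g r)%E) ->
  (\int[mu]_(r in `[(a - s)%R, (b - s)%R]) g (r + s)%R = \int[mu]_(r in `[a, b]) g r)%E.
Proof.
move=> mg g0.
have ms : measurable_fun [set: measurableTypeR R]
    ((fun r => r + s) : measurableTypeR R -> measurableTypeR R).
  exact: measurable_funD.
rewrite [LHS](_ : _ = (\int[mu]_(r in
    (fun r : measurableTypeR R => (r + s : measurableTypeR R)%R) @^-1` `[a, b])
    (g \o (fun r => r + s)%R) r)%E); last first.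
  by congr (integral _ _ _); apply/seteqP; split => r /=; rewrite !in_itv /= lerBlDr lerBrDr.
rewrite -ge0_integral_pushforward//=.
- by apply: eq_measure_integral => //= A mA _; exact: lebesgue_measure_shift.
- by move=> r; rewrite inE => /g0.
Qed.

Lemma integral_shift (g : R -> \bar R) (s a b : R) :
  measurable_fun `[a, b] g ->
  (\int[mu]_(r in `[(a - s)%R, (b - s)%R]) g (r + s)%R = \int[mu]_(r in `[a, b]) g r)%E.
Proof.
move=> mg; rewrite integralE [RHS]integralE.
congr (_ - _)%E.
- apply: etrans (@ge0_integral_shift (g^\+)%E s a b _ _) => //.
    by apply: eq_integral => r _; rewrite !funeposE.
  exact: measurable_funepos.
- apply: etrans (@ge0_integral_shift (g^\-)%E s a b _ _) => //.
    by apply: eq_integral => r _; rewrite !funenegE.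
  exact: measurable_funeneg.
Qed.

Lemma measurable_fun_shift d (T : measurableType d) (g : R -> T) (s a b : R) :
  measurable_fun `[a, b] g ->
  measurable_fun `[a - s, b - s] (fun r => g (r + s)).
Proof.
move=> mg; apply: (@measurable_comp _ _ _ _ _ _ `[a, b]) => //.
- move=> _ [r + <-] /=; rewrite !in_itv/= => /andP[ra rb].
  by apply/andP; split; [rewrite -lerBlDr|rewrite -lerBrDr].
- by apply: measurable_funD.
Qed.

Lemma integrable_shift (g : R -> R) (s a b : R) :
  mu.-integrable `[a, b] (EFin \o g) ->
  mu.-integrable `[a - s, b - s] (EFin \o (fun r => g (r + s))).
Proof.
move=> /integrableP[mg ig]; apply/integrableP; split.
  exact: (@measurable_fun_shift _ _ (EFin \o g) s a b mg).
rewrite (@ge0_integral_shift (fun r => `|(EFin \o g) r|%E))//.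
exact: measurableT_comp.
Qed.

Lemma integral_expRN (lam T : R) : 0 < lam ->
  (\int[mu]_(r in `[T, +oo[) (expR (- (lam * r)))%:E = (expR (- (lam * T)) / lam)%:E)%E.
Proof.
move=> lam0; have ln0 : lam != 0 by rewrite gt_eqF.
pose F (r : R) := - (expR (- (lam * r)) / lam).
have dF (r : R) : is_derive r (1 : R) F (expR (- (lam * r))).
  rewrite /F; apply: is_derive_eq.
  rewrite /GRing.scale /= !mulr1; field.
  by rewrite ln0.
have cE : continuous (fun r : R => expR (- (lam * r))).
  move=> r; apply: continuous_comp; last exact: continuous_expR.
  by apply: continuousN; apply: cvgM; [exact: cvg_cst|exact: cvg_id].
rewrite (@ge0_continuous_FTC2y _ _ F _ 0)//.
- by rewrite /F EFinN oppeK add0e.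
- by apply: continuous_subspaceT.
- rewrite -oppr0; apply: cvgN; rewrite -(mul0r lam^-1); apply: cvgM; last exact: cvg_cst.
  apply: (@cvg_comp _ _ _ (fun r => lam * r) (fun r => expR (- r)) _ (pinfty_nbhs R));
    last exact: cvgr_expR.
  exact: gt0_cvgMry.
- by apply: cvgN; apply: cvgM; [exact/cvg_at_right_filter/cE|exact: cvg_cst].
- by move=> r _; rewrite derive1E; apply: derive_val.
Qed.

Lemma integral_expRN_itv0 (T : R) : 0 <= T ->
  (\int[mu]_(r in `[0%R, T]) (expR (- r))%:E = (1 - expR (- T))%:E)%E.
Proof.
rewrite le_eqVlt => /predU1P[<-|T0].
  by rewrite set_itv1 integral_set1 oppr0 expR0 subrr.
have cE : continuous (fun r : R => expR (- r)).
  by move=> r; apply: continuous_comp; [exact: opp_continuous|exact: continuous_expR].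
have dF (r : R) : is_derive r (1 : R) (fun r : R => - expR (- r)) (expR (- r)).
  by apply: is_derive_eq; rewrite /GRing.scale /=; ring.
rewrite (@continuous_FTC2 _ _ (fun r => - expR (- r))) //.
- by rewrite oppr0 expR0 -EFinB opprK addrC.
- exact: continuous_subspaceT.
- split.
  + by move=> z _; exact: ex_derive.
  + by apply/cvg_at_right_filter; apply: cvgN; exact: cE.
  + by apply/cvg_at_left_filter; apply: cvgN; exact: cE.
- by move=> z _; rewrite derive1E; apply: derive_val.
Qed.
End integrals.

(** * Controls, trajectories and value functions *)

Section enorm2.
Context {R : realType} {n : nat}.
Implicit Types (x y : 'rV[R]_n).

Lemma enorm2_ge0 x : 0 <= enorm2 x.
Proof. by apply: sumr_ge0 => i _; exact: sqr_ge0. Qed.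

Lemma enorm2Z (c : R) x : enorm2 (c *: x) = c ^+ 2 * enorm2 x.
Proof. by rewrite /enorm2 mulr_sumr; apply: eq_bigr => i _; rewrite mxE exprMn. Qed.

Lemma enorm2N x : enorm2 (- x) = enorm2 x.
Proof. by apply: eq_bigr => i _; rewrite mxE sqrrN. Qed.

Lemma enorm2_0 : enorm2 (0 : 'rV[R]_n) = 0.
Proof. by apply: big1 => i _; rewrite mxE expr0n. Qed.

Lemma enorm2DB x y : enorm2 (x + y) + enorm2 (x - y) = 2 * enorm2 x + 2 * enorm2 y.
Proof.
rewrite /enorm2 !mulr_sumr -!big_split /=; apply: eq_bigr => i _.
by rewrite !mxE; ring.
Qed.

Lemma coord_le_norm x (i : 'I_n) : `|x ord0 i| <= `|x|.
Proof.
by rewrite /Num.norm/= mx_normrE; exact: (le_bigmax _ _ (ord0, i)).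
Qed.

Lemma enorm2_le_norm x : enorm2 x <= n%:R * `|x| ^+ 2.
Proof.
rewrite /enorm2 mulr_natl -[X in _ *+ X]card_ord -sumr_const.
apply: ler_sum => i _; rewrite -[leLHS]real_normK ?num_real// lerXn2r ?nnegrE//.
exact: coord_le_norm.
Qed.

Lemma norm_le_enorm2 x : `|x| ^+ 2 <= enorm2 x.
Proof.
have [x0|x0] := eqVneq `|x| 0; first by rewrite x0 expr0n enorm2_ge0.
have [[i j] xij] := mx_norm_neq0 x0.
have -> : `|x| = `|x ord0 j| by have := xij; rewrite /= (ord1 i).
rewrite real_normK ?num_real//.
by rewrite /enorm2 (bigD1 j)//= lerDl sumr_ge0// => k _; exact: sqr_ge0.
Qed.

End enorm2.

Section controls.
Context {R : realType} {n : nat}.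
Notation mu := (@lebesgue_measure R).
Implicit Types (x y : 'rV[R]_n) (alpha : R -> 'rV[R]_n) (f : 'rV[R]_n -> R).

Lemma measurable_control alpha (i : 'I_n) (T : R) : admissible alpha ->
  measurable_fun `[0, T] (fun s => alpha s ord0 i).
Proof.
move=> aa; have [T0|T0] := leP 0 T.
  by have /integrableP[/measurable_EFinP] := aa i T T0.
by rewrite set_itv_ge ?bnd_simp -?ltNge// ; exact: measurable_fun_set0.
Qed.

Lemma continuous_rV (T : topologicalType) (g : T -> 'rV[R]_n) (t : T) :
  (forall i, {for t, continuous (fun s => g s ord0 i)}) -> {for t, continuous g}.
Proof.
move=> gc; apply/cvg_ballP => e e0.
have : \forall s \near t, forall i, ball (g t ord0 i) e (g s ord0 i).
  by apply: filter_forall => i; have /cvg_ballP := gc i; exact.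
by apply: filterS => s gs; split => // j i; rewrite (ord1 j).
Qed.

Lemma continuous_trajectory x alpha (T : R) : admissible alpha ->
  {within `[0, T], continuous (trajectory x alpha)}.
Proof.
move=> aa t; apply: continuous_rV => i; move: t.
have [T0|T0] := leP 0 T; last first.
  rewrite set_itv_ge ?bnd_simp -?ltNge//; exact: continuous_subspace0.
rewrite [X in continuous X](_ : _ = (fun s => x ord0 i +
    parameterized_integral mu 0 s (fun r => alpha r ord0 i))); last first.
  by apply/funext => s; rewrite !mxE.
move=> t; apply: cvgD; first exact: cvg_cst.
exact: (parameterized_integral_continuous T0 (aa i T T0)).
Qed.

Lemma measurable_enorm2 alpha (T : R) : admissible alpha ->
  measurable_fun `[0, T] (fun s => enorm2 (alpha s)).
Proof.
move=> aa; apply: measurable_sum => i; apply: measurable_funX.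
exact: measurable_control.
Qed.

Lemma measurable_running_cost f x alpha (T : R) : continuous f -> admissible alpha ->
  measurable_fun `[0, T] (fun s => f (trajectory x alpha s)).
Proof.
move=> cf aa; apply: subspace_continuous_measurable_fun => //.
apply: (@within_continuous_comp _ _ _ _ (trajectory x alpha) f).
  by move=> y _; exact: cf.
exact: continuous_trajectory.
Qed.

Lemma measurable_lagrangian f x alpha (T : R) : continuous f -> admissible alpha ->
  measurable_fun `[0, T] (lagrangian f x alpha).
Proof.
move=> cf aa; apply: measurable_funD; last exact: measurable_running_cost.
apply: measurable_funM; last exact: measurable_cst.
exact: measurable_enorm2.
Qed.

Lemma measurable_fun_itvcy d (T : measurableType d) (g : R -> T) :
  (forall t : R, measurable_fun `[0, t] g) -> measurable_fun (`[0, +oo[ : set R) g.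
Proof.
move=> mg; have -> : `[0, +oo[%classic = \bigcup_(k : nat) `[0, k%:R]%classic :> set R.
  apply/seteqP; split => r /=; rewrite ?in_itv/= ?andbT.
    move=> r0; have rk := archi_boundP r0; exists (Num.bound r) => //=.
    by rewrite in_itv/= r0 ltW.
  by move=> [k _] /=; rewrite in_itv/= => /andP[].
by apply/measurable_fun_bigcup => // k.
Qed.

End controls.

Section infima.
Context {R : realType}.

Lemma ereal_inf_fin_numP (S : set (\bar R)) (a c : R) :
  (forall y, S y -> (a%:E <= y)%E) -> (exists2 y, S y & (y <= c%:E)%E) ->
  ereal_inf S \is a fin_num.
Proof.
move=> Sa [y Sy yc]; rewrite fin_numE; apply/andP; split.
- rewrite gt_eqF// (@lt_le_trans _ _ a%:E) ?ltNyr//.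
  by apply: le_ereal_inf_tmp => z; exact: Sa.
- rewrite lt_eqF// (@le_lt_trans _ _ c%:E) ?ltry//.
  by apply: le_trans yc; exact: ereal_inf_lbound.
Qed.

Lemma fine_ereal_infE (S : set (\bar R)) (v : R) :
  (forall y, S y -> (v%:E <= y)%E) ->
  (forall e : R, 0 < e -> exists2 y, S y & (y <= (v + e)%:E)%E) ->
  fine (ereal_inf S) = v.
Proof.
move=> Sv vS; suff -> : ereal_inf S = v%:E by [].
apply/eqP; rewrite eq_le; apply/andP; split; last by apply: le_ereal_inf_tmp => y /Sv.
apply/lee_addgt0Pr => e /vS[y Sy yv]; rewrite -EFinD.
by apply: le_trans yv; exact: ereal_inf_lbound.
Qed.

End infima.

Section value.
Context {R : realType} {n : nat}.
Notation mu := (@lebesgue_measure R).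
Variables (f : 'rV[R]_n -> R) (B : R).
Hypotheses (cf : continuous f) (f_ge0 : forall x, 0 <= f x)
  (f_leB : forall x, f x <= B).
Implicit Types (s t e c : R) (x y : 'rV[R]_n) (alpha : R -> 'rV[R]_n).

Let B_ge0 : 0 <= B. Proof. exact: le_trans (f_ge0 0) (f_leB 0). Qed.

Lemma lagrangian_ge0 x alpha s : 0 <= lagrangian f x alpha s.
Proof. by rewrite addr_ge0// divr_ge0// enorm2_ge0. Qed.

Lemma cost_ge0 x t alpha : (0 <= finite_horizon_cost f x t alpha)%E.
Proof. by apply: integral_ge0 => s _; rewrite lee_fin lagrangian_ge0. Qed.

Lemma itv_measure0 (t : R) : 0 <= t -> mu `[0, t]%classic = t%:E.
Proof.
move=> t0; rewrite lebesgue_measure_itv/= lte_fin.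
by move: t0; rewrite le_eqVlt => /predU1P[<-|->]; rewrite ?ltxx ?sube0 ?subr0.
Qed.

Lemma admissible_cst (q : 'rV[R]_n) : admissible (fun=> q).
Proof.
move=> i T T0; apply/integrableP; split; first exact: measurable_cst.
rewrite [X in (X < _)%E]integral_cst//= itv_measure0//.
by rewrite -EFinM ltry.
Qed.

Lemma trajectory_cst x (q : 'rV[R]_n) s : 0 <= s -> trajectory x (fun=> q) s = x + s *: q.
Proof.
move=> s0; rewrite /trajectory; congr (_ + _); apply/rowP => i.
by rewrite !mxE Rintegral_cst// [X in fine X](itv_measure0 s0) mulrC.
Qed.

Lemma cost_cst_le x (q : 'rV[R]_n) (s c : R) : 0 <= s ->
  (forall r, 0 <= r <= s -> f (x + r *: q) <= c) ->
  (finite_horizon_cost f x s (fun=> q) <= (s * (enorm2 q / 2 + c))%:E)%E.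
Proof.
move=> s0 fc.
apply: (@le_trans _ _ (\int[mu]_(r in `[0%R, s]) (enorm2 q / 2 + c)%:E)%E).
  apply: ge0_le_integral => //.
  - by move=> r _; rewrite lee_fin lagrangian_ge0.
  - apply/measurable_EFinP; apply: measurable_lagrangian => //.
    exact: admissible_cst.
  - move=> r /=; rewrite in_itv/= => r0s; rewrite lee_fin lerD2l.
    by rewrite trajectory_cst ?fc//; case/andP: r0s.
by rewrite integral_cst// [X in (_ * X)%E](itv_measure0 s0) -EFinM mulrC.
Qed.

Lemma cost_fin_num x t : 0 <= t ->
  ereal_inf (finite_horizon_cost f x t @` @admissible R n) \is a fin_num.
Proof.
move=> t0; apply: (@ereal_inf_fin_numP _ _ 0 (t * (enorm2 (0 : 'rV[R]_n) / 2 + B))).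
  by move=> _ [alpha _ <-]; exact: cost_ge0.
exists (finite_horizon_cost f x t (fun=> 0)).
  by exists (fun=> 0) => //; exact: admissible_cst.
by apply: cost_cst_le.
Qed.

Lemma value_le x t alpha : 0 <= t -> admissible alpha ->
  ((value f x t)%:E <= finite_horizon_cost f x t alpha)%E.
Proof.
move=> t0 aa; rewrite fineK ?cost_fin_num//; apply: ereal_inf_lbound.
by exists alpha.
Qed.

Lemma value_approx x t e : 0 <= t -> 0 < e ->
  exists2 alpha, admissible alpha &
    (finite_horizon_cost f x t alpha <= (value f x t + e)%:E)%E.
Proof.
move=> t0 e0; have [_ [alpha aa <-] h] := lb_ereal_inf_adherent e0 (cost_fin_num x t0).
by exists alpha => //; rewrite EFinD fineK ?cost_fin_num// ltW.
Qed.

Lemma value_ge0 x t : 0 <= value f x t.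
Proof.
by apply: fine_ge0; apply: le_ereal_inf_tmp => _ [alpha _ <-]; exact: cost_ge0.
Qed.

Lemma le_value x s t : 0 <= s <= t -> value f x s <= value f x t.
Proof.
move=> /andP[s0 st]; have t0 := le_trans s0 st.
apply/ler_addgt0Pr => e /(value_approx x t0)[alpha aa h].
rewrite -lee_fin (le_trans _ h)// (le_trans (value_le x s0 aa))//.
apply: ge0_subset_integral => //.
- by apply/measurable_EFinP; exact: measurable_lagrangian.
- by move=> r _; rewrite lee_fin lagrangian_ge0.
- by apply: subset_itvl; rewrite bnd_simp.
Qed.

Lemma value_eq0 x t : 0 <= t -> f x = 0 -> value f x t = 0.
Proof.
move=> t0 fx; apply/eqP; rewrite eq_le value_ge0 andbT -lee_fin.
apply: le_trans (value_le x t0 (admissible_cst 0)) _.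
apply: le_trans (@cost_cst_le x 0 t 0 t0 _) _; last by rewrite enorm2_0 mul0r addr0 mulr0.
by move=> r _; rewrite scaler0 addr0 fx.
Qed.

End value.

(** * Dynamic programming: restarting and concatenating controls *)

Section dynamic_programming.
Context {R : realType} {n : nat}.
Notation mu := (@lebesgue_measure R).
Implicit Types (s t e c r : R) (x y : 'rV[R]_n) (alpha : R -> 'rV[R]_n).

Lemma itv0_splitU (s t : R) : 0 <= s -> 0 <= t ->
  `[0, s + t]%classic = `[0, s] `|` `]s, s + t] :> set R.
Proof.
by move=> s0 t0; rewrite -itv_bndbnd_setU// bnd_simp// lerDl.
Qed.

Lemma disjoint_split (s t : R) : [disjoint `[0, s]%classic & `]s, s + t]%classic].
Proof.
apply/disj_setPS => r [/=]; rewrite !in_itv/= => /andP[_ rs] /andP[sr _].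
by move: sr; rewrite ltNge rs.
Qed.

Lemma ge0_integral_splitU (g : R -> \bar R) (s t : R) : 0 <= s -> 0 <= t ->
  measurable_fun `[0, s + t] g -> (forall r, (0 <= g r)%E) ->
  (\int[mu]_(r in `[0%R, (s + t)%R]) g r =
   \int[mu]_(r in `[0%R, s]) g r + \int[mu]_(r in `[s, (s + t)%R]) g r)%E.
Proof.
move=> s0 t0 mg g0; rewrite itv0_splitU// in mg *.
rewrite (@ge0_integral_setU _ _ _ mu _ _ (measurable_itv _) (measurable_itv _) _
  mg (fun r _ => g0 r) (disjoint_split s t)).
congr (_ + _)%E; rewrite integral_itv_obnd_cbnd//.
apply: measurable_funS mg; last exact: subsetUr.
by apply: measurableU; exact: measurable_itv.
Qed.

Lemma admissible_shift s alpha : 0 <= s -> admissible alpha ->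
  admissible (fun r => alpha (r + s)).
Proof.
move=> s0 aa i T T0.
have := @integrable_shift R (fun r => alpha r ord0 i) s s (T + s).
rewrite subrr addrK; apply.
apply: (@integrableS _ _ _ mu `[0, T + s]) => //.
  by apply: subset_itvr; rewrite bnd_simp.
exact: (aa i _ (addr_ge0 T0 s0)).
Qed.

Lemma trajectory_shift x alpha s r : admissible alpha -> 0 <= s -> 0 <= r ->
  trajectory x alpha (r + s) =
  trajectory (trajectory x alpha s) (fun r => alpha (r + s)) r.
Proof.
move=> aa s0 r0; rewrite /trajectory -addrA; congr (_ + _).
apply/rowP => i; rewrite !mxE.
have intsr := aa i _ (addr_ge0 r0 s0).
have intsr' : mu.-integrable `[s, r + s] (EFin \o (fun r => alpha r ord0 i)).
  by apply: integrableS intsr => //; apply: subset_itvr; rewrite bnd_simp.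
have := @Rintegral_itvB R _ _ _ s intsr.
rewrite !bnd_simp lerDr => /(_ s0 r0) /eqP; rewrite subr_eq addrC => /eqP ->.
congr (_ + _).
rewrite Rintegral_itv_obnd_cbnd//; last first.
  by apply: integrableS intsr' => //; apply: subset_itvr; rewrite bnd_simp.
rewrite /Rintegral -(@integral_shift R (fun r => (alpha r ord0 i)%:E) s s (r + s)).
  by rewrite subrr addrK.
by case/integrableP: intsr'.
Qed.

Variables (f : 'rV[R]_n -> R) (B : R).
Hypotheses (cf : continuous f) (f_ge0 : forall x, 0 <= f x)
  (f_leB : forall x, f x <= B).

Lemma cost_split x s t alpha : admissible alpha -> 0 <= s -> 0 <= t ->
  (finite_horizon_cost f x (s + t) alpha =
   finite_horizon_cost f x s alpha +
   finite_horizon_cost f (trajectory x alpha s) t (fun r => alpha (r + s)%R))%E.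
Proof.
move=> aa s0 t0.
have mL : measurable_fun `[0, s + t] (EFin \o lagrangian f x alpha).
  by apply/measurable_EFinP; exact: measurable_lagrangian.
have L0 r : (0 <= (EFin \o lagrangian f x alpha) r)%E.
  by rewrite /= lee_fin lagrangian_ge0.
rewrite [LHS](@ge0_integral_splitU (EFin \o lagrangian f x alpha) s t s0 t0 mL L0).
have mL' : measurable_fun `[s, s + t] (EFin \o lagrangian f x alpha).
  by apply: measurable_funS mL => //; apply: subset_itvr; rewrite bnd_simp.
have := @ge0_integral_shift R (EFin \o lagrangian f x alpha) s s (s + t) mL' (fun r _ => L0 r).
rewrite subrr addrAC subrr add0r => <-.
suff -> : (\int[mu]_(r in `[0%R, t]) (EFin \o lagrangian f x alpha) (r + s)%R =
    finite_horizon_cost f (trajectory x alpha s) t (fun r => alpha (r + s)%R))%E by [].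
apply: eq_integral => r.
rewrite inE/= in_itv/= => /andP[r0 _].
by rewrite /lagrangian trajectory_shift.
Qed.

Definition concat s alpha beta r : 'rV[R]_n := if r < s then alpha r else beta (r - s).

Lemma concat_shift s alpha beta r : 0 <= r -> concat s alpha beta (r + s) = beta r.
Proof. by move=> r0; rewrite /concat ltNge lerDr r0 /= addrK. Qed.

Lemma admissible_concat s alpha beta : 0 <= s ->
  admissible alpha -> admissible beta -> admissible (concat s alpha beta).
Proof.
move=> s0 aa ab i T T0.
pose g r := concat s alpha beta r ord0 i.
have i1 : mu.-integrable `[0, s[ (EFin \o g).
  apply: (@eq_integrable _ _ _ mu _ _ (fun r => (alpha r ord0 i)%:E)) => //.
    by move=> r; rewrite inE/= in_itv/= => /andP[_ rs]; rewrite /g /concat rs.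
  apply: integrableS (aa i s s0) => //.
  by apply: subset_itvl; rewrite bnd_simp.
have i2 : mu.-integrable `[s, s + T] (EFin \o g).
  apply: (@eq_integrable _ _ _ mu _ _ (fun r => (beta (r - s) ord0 i)%:E)) => //.
    move=> r; rewrite inE/= in_itv/= => /andP[rs _].
    by rewrite /g /concat ltNge rs.
  have := @integrable_shift R _ (- s) _ _ (ab i T T0).
  by rewrite opprK add0r addrC; apply.
have E : `[0, s + T]%classic = `[0, s[ `|` `[s, s + T] :> set R.
  by rewrite -itv_bndbnd_setU// bnd_simp// lerDl.
apply: (@integrableS _ _ _ mu `[0, s + T]) => //.
  by apply: subset_itvl; rewrite bnd_simp lerDr.
case/integrableP: i1 => m1 f1; case/integrableP: i2 => m2 f2.
have mg : measurable_fun `[0, s + T] (EFin \o g) by rewrite E measurable_funU.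
apply/integrableP; split => //.
rewrite E ge0_integral_setU//; last 2 first.
- by rewrite -E; exact: measurableT_comp.
- apply/disj_setPS => r [/=]; rewrite !in_itv/= => /andP[_ rs] /andP[sr _].
  by move: sr; rewrite leNgt rs.
exact: lte_add_pinfty.
Qed.

Lemma trajectory_concat x s alpha beta r : admissible alpha -> admissible beta ->
  0 <= r <= s ->
  trajectory x (concat s alpha beta) r = trajectory x alpha r.
Proof.
move=> aa ab /andP[r0 rs]; rewrite /trajectory; congr (_ + _).
have s0 := le_trans r0 rs.
apply/rowP => i; rewrite !mxE.
have ic : mu.-integrable `[0, r[ (fun r => (concat s alpha beta r ord0 i)%:E).
  apply: integrableS (admissible_concat s0 aa ab i r0) => //.
  by apply: subset_itvl; rewrite bnd_simp.
have ia : mu.-integrable `[0, r[ (fun r => (alpha r ord0 i)%:E).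
  by apply: integrableS (aa i _ r0) => //; apply: subset_itvl; rewrite bnd_simp.
(* At time [s] itself the concatenation already follows [beta]; half-open intervals drop this point
   when [r = s]. *)
rewrite -Rintegral_itv_bndo_bndc// -[RHS]Rintegral_itv_bndo_bndc//.
apply: eq_Rintegral => u; rewrite inE/= in_itv/= => /andP[_ ur].
by rewrite /concat (lt_le_trans ur rs).
Qed.

Lemma cost_concat x s t alpha beta : admissible alpha -> admissible beta ->
  0 <= s -> 0 <= t ->
  (finite_horizon_cost f x (s + t) (concat s alpha beta) =
   finite_horizon_cost f x s alpha +
   finite_horizon_cost f (trajectory x alpha s) t beta)%E.
Proof.
move=> aa ab s0 t0; have ac := admissible_concat s0 aa ab.
have ml (y : 'rV[R]_n) (g : R -> 'rV[R]_n) (T : R) : admissible g ->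
    measurable_fun `[0, T[ (EFin \o lagrangian f y g).
  move=> ag; apply/measurable_EFinP.
  apply: measurable_funS (@measurable_lagrangian _ _ f y _ T cf ag) => //.
  by apply: subset_itvl; rewrite bnd_simp.
have ts : trajectory x (concat s alpha beta) s = trajectory x alpha s.
  by apply: trajectory_concat => //; rewrite s0 lexx.
rewrite (cost_split x ac s0 t0) ts.
have -> : finite_horizon_cost f x s (concat s alpha beta) = finite_horizon_cost f x s alpha.
  rewrite /finite_horizon_cost -(integral_itv_bndo_bndc (ml x _ s ac)).
  rewrite -(integral_itv_bndo_bndc (ml x _ s aa)).
  apply: eq_integral => r; rewrite inE/= in_itv/= => /andP[r0 rs].
  by rewrite /lagrangian trajectory_concat ?r0 ?(ltW rs)// /concat rs.
suff -> : finite_horizon_cost f (trajectory x alpha s) t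
    (fun r => concat s alpha beta (r + s)) =
    finite_horizon_cost f (trajectory x alpha s) t beta by [].
apply: eq_integral => r; rewrite inE/= in_itv/= => /andP[r0 rt].
rewrite /lagrangian concat_shift//.
suff -> : trajectory (trajectory x alpha s) (fun r => concat s alpha beta (r + s)) r =
    trajectory (trajectory x alpha s) beta r by [].
rewrite /trajectory; congr (_ + _).
apply/rowP => i; rewrite !mxE; apply: eq_Rintegral => u.
by rewrite inE/= in_itv/= => /andP[u0 _]; rewrite concat_shift.
Qed.

(** Test control: velocity [q] up to time [s], then an almost optimal one from the point reached.
    Choices of [q] and [s] give the bound on the value, its Lipschitz constant and the subsolution
    property. *)
Lemma value_le_cst x (q : 'rV[R]_n) s t c : 0 <= s -> 0 <= t ->
  (forall r, 0 <= r <= s -> f (x + r *: q) <= c) ->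
  value f x (s + t) <= s * (enorm2 q / 2 + c) + value f (x + s *: q) t.
Proof.
move=> s0 t0 fc; apply/ler_addgt0Pr => e e0.
have [alpha aa h] := value_approx cf f_ge0 f_leB (x + s *: q) t0 e0.
have aq := @admissible_cst R n q.
rewrite -lee_fin.
apply: (le_trans (value_le cf f_ge0 f_leB x (addr_ge0 s0 t0) (admissible_concat s0 aq aa))).
rewrite (cost_concat _ aq aa s0 t0) (trajectory_cst _ _ s0).
rewrite -[X in (_ <= X%:E)%E]addrA [leRHS]EFinD.
exact: leeD (cost_cst_le cf f_ge0 s0 fc) h.
Qed.

End dynamic_programming.

(** * Integral inequalities, with infinite values allowed *)

Section integral_inequalities.
Context {R : realType}.
Notation mu := (@lebesgue_measure R).

Lemma ge0_integrable (D : set R) (g : R -> R) : measurable D ->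
  measurable_fun D g -> (forall r, D r -> 0 <= g r) ->
  (\int[mu]_(r in D) (g r)%:E < +oo)%E -> mu.-integrable D (EFin \o g).
Proof.
move=> mD mg g0 ig; apply/integrableP; split; first exact/measurable_EFinP.
apply: le_lt_trans ig; apply: ge0_le_integral => //.
- by apply: measurableT_comp => //; apply/measurable_EFinP.
- exact/measurable_EFinP.
- by move=> r Dr /=; rewrite ger0_norm// g0.
Qed.

(** The integral of [g] may be infinite, as for a control of infinite energy. The negative part of
    [g + c] is at most [|c|], hence has finite integral, while [g] is at most the positive part plus
    [|c|], which forces the positive part to have infinite integral whenever [g] does. *)
Lemma ge0_integralD_integrable (D : set R) (g c : R -> R) : measurable D ->
  measurable_fun D g -> (forall r, D r -> 0 <= g r) ->
  mu.-integrable D (EFin \o c) ->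
  (\int[mu]_(r in D) (g r + c r)%:E =
   \int[mu]_(r in D) (g r)%:E + \int[mu]_(r in D) (c r)%:E)%E.
Proof.
move=> mD mg g0 ic.
have mc : measurable_fun D c by case/integrableP: ic => /measurable_EFinP.
have [ig|] := eqVneq (\int[mu]_(r in D) (g r)%:E)%E +oo%E; last first.
  rewrite -ltey => ig; apply: (@integralD_EFin _ _ _ mu _ mD g c) => //.
  exact: ge0_integrable.
have iabs : (\int[mu]_(r in D) `|c r|%:E < +oo)%E by case/integrableP: ic.
have mh : measurable_fun D (fun r => (g r + c r)%:E).
  by apply/measurable_EFinP; exact: measurable_funD.
have mabs : measurable_fun D (fun r => `|c r|%:E).
  by apply/measurable_EFinP; exact: measurableT_comp.
have hn : (\int[mu]_(r in D) (fun r => (g r + c r)%:E)^\- r < +oo)%E.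
  apply: le_lt_trans iabs; apply: ge0_le_integral => //.
  - exact: measurable_funeneg.
  - move=> r Dr; rewrite funenegE -EFinN -EFin_max lee_fin ge_max normr_ge0 andbT.
    have := g0 _ Dr; have := ler_norm (- c r); rewrite normrN; lra.
have hp : (\int[mu]_(r in D) (fun r => (g r + c r)%:E)^\+ r = +oo)%E.
  have : (\int[mu]_(r in D) (g r)%:E <=
      \int[mu]_(r in D) ((fun r => (g r + c r)%:E)^\+ r + `|c r|%:E))%E.
    apply: ge0_le_integral => //.
    - by apply/measurable_EFinP.
    - by apply: emeasurable_funD => //; exact: measurable_funepos.
    - move=> r Dr; rewrite funeposE -EFin_max -EFinD lee_fin.
      have : g r + c r <= Num.max (g r + c r) 0 by rewrite le_max lexx.
      have := ler_norm (- c r); rewrite normrN; lra.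
  rewrite ge0_integralD//; last exact: measurable_funepos.
  rewrite ig leye_eq; move: iabs.
  move: (\int[mu]_(r in D) `|c r|%:E)%E (\int[mu]_(r in D) _^\+ r)%E.
  by move=> [a||] [b||].
have icn : (\int[mu]_(r in D) (c r)%:E)%E \is a fin_num by exact: integrable_fin_num.
have hn0 : (0 <= \int[mu]_(r in D) (fun r => (g r + c r)%:E)^\- r)%E.
  by apply: integral_ge0.
rewrite integralE hp ig.
move: icn hn hn0.
move: (\int[mu]_(r in D) _^\- r)%E (\int[mu]_(r in D) (c r)%:E)%E.
by move=> [a||] [b||].
Qed.

(** Jensen's inequality for the square: with [m] the mean of [g], integrate the tangent line bound
    [g^2 / 2 >= m g - m^2 / 2]. *)
Lemma sqr_integral_le (g : R -> R) (r : R) : 0 < r ->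
  mu.-integrable `[0, r] (EFin \o g) ->
  (((\int[mu]_(s in `[0, r]) g s) ^+ 2 / (2 * r))%:E <=
   \int[mu]_(s in `[0%R, r]) (g s ^+ 2 / 2)%:E)%E.
Proof.
move=> r0 ig; set a := (\int[mu]_(s in `[0, r]) g s)%R; pose m := a / r.
have mg : measurable_fun `[0, r] g by case/integrableP: ig => /measurable_EFinP.
have [->|] := eqVneq (\int[mu]_(s in `[0%R, r]) (g s ^+ 2 / 2)%:E)%E +oo%E.
  by rewrite leey.
rewrite -ltey => fin.
have i2 : mu.-integrable `[0, r] (EFin \o (fun s => g s ^+ 2 / 2)).
  apply: ge0_integrable => // [|s _]; last by rewrite divr_ge0// sqr_ge0.
  by apply: measurable_funM => //; exact: measurable_funX.
have icst (k : R) : mu.-integrable `[0, r] (EFin \o cst k).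
  apply: continuous_compact_integrable; first exact: segment_compact.
  by apply: continuous_subspaceT => u; exact: cvg_cst.
have i1 : mu.-integrable `[0, r] (EFin \o (fun s => m * g s)).
  exact: (@integrableZl _ _ _ mu _ (measurable_itv _) m _ ig).
have i3 : mu.-integrable `[0, r] (EFin \o (fun s => m * g s - m ^+ 2 / 2)).
  exact: (@integrableB _ _ _ mu _ (measurable_itv _)
    (EFin \o (fun s => m * g s)) (EFin \o cst (m ^+ 2 / 2))).
apply: (@le_trans _ _ (\int[mu]_(s in `[0%R, r]) (m * g s - m ^+ 2 / 2)%:E)%E); last first.
  apply: le_integral => // s _; rewrite lee_fin.
  have := sqr_ge0 (g s - m); nra.
have -> : (\int[mu]_(s in `[0%R, r]) (m * g s - m ^+ 2 / 2)%:E =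
    (\int[mu]_(s in `[0%R, r]) (m * g s - cst (m ^+ 2 / 2) s)%R)%:E)%E.
  by rewrite fineK// integrable_fin_num.
rewrite (@RintegralB _ _ _ mu _ _ _ (measurable_itv _) i1 (icst _)).
rewrite (@RintegralZl _ _ _ mu _ _ m (measurable_itv _) ig).
rewrite (@Rintegral_cst _ _ _ mu _ (measurable_itv _)).
rewrite [X in fine X](itv_measure0 (ltW r0)) /= lee_fin.
rewrite -/a /m le_eqVlt; apply/orP; left; apply/eqP; field.
by rewrite gt_eqF.
Qed.

End integral_inequalities.

(** * Energy of a path and the lower half of dynamic programming *)

Section lower_estimates.
Context {R : realType} {n : nat}.
Notation mu := (@lebesgue_measure R).
Implicit Types (s t e c r : R) (x y : 'rV[R]_n) (alpha : R -> 'rV[R]_n).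

Lemma measurable_kinetic alpha t : admissible alpha ->
  measurable_fun `[0, t] (fun s => (enorm2 (alpha s) / 2)%:E).
Proof.
move=> aa; apply/measurable_EFinP; apply: measurable_funM => //.
exact: measurable_enorm2.
Qed.

Lemma kinetic_ge0 alpha s : (0 <= (enorm2 (alpha s) / 2)%:E)%E.
Proof. by rewrite lee_fin divr_ge0// enorm2_ge0. Qed.

(** Among paths with given end points and duration the straight one has least energy; Jensen's
    inequality is applied to each coordinate. *)
Lemma enorm2_trajectory_le x alpha r : 0 < r -> admissible alpha ->
  ((enorm2 (trajectory x alpha r - x) / (2 * r))%:E <=
   \int[mu]_(s in `[0%R, r]) (enorm2 (alpha s) / 2)%:E)%E.
Proof.
move=> r0 aa; have ai i := aa i r (ltW r0).
have -> : (\int[mu]_(s in `[0%R, r]) (enorm2 (alpha s) / 2)%:E =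
    \sum_(i < n) \int[mu]_(s in `[0%R, r]) ((alpha s ord0 i) ^+ 2 / 2)%:E)%E.
  rewrite -(@ge0_integral_sum _ _ _ mu _ (measurable_itv _) _
    (fun i s => ((alpha s ord0 i) ^+ 2 / 2)%:E)).
  - by apply: eq_integral => s _; rewrite sumEFin /enorm2 mulr_suml.
  - move=> i; apply/measurable_EFinP; apply: measurable_funM => //.
    by apply: measurable_funX; exact: measurable_control.
  - by move=> i s _; rewrite lee_fin divr_ge0// sqr_ge0.
rewrite /enorm2 mulr_suml -sumEFin; apply: lee_sum => i _.
apply: le_trans (sqr_integral_le r0 (ai i)).
by rewrite /trajectory addrAC subrr add0r mxE.
Qed.

Variables (f : 'rV[R]_n -> R) (B : R).
Hypotheses (cf : continuous f) (f_ge0 : forall x, 0 <= f x)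
  (f_leB : forall x, f x <= B).

Lemma costE x t alpha : admissible alpha ->
  (finite_horizon_cost f x t alpha =
   \int[mu]_(s in `[0%R, t]) (enorm2 (alpha s) / 2)%:E +
   \int[mu]_(s in `[0%R, t]) (f (trajectory x alpha s))%:E)%E.
Proof.
move=> aa; apply: (@ge0_integralD _ _ _ mu _ (measurable_itv _)
  (fun s => (enorm2 (alpha s) / 2)%:E) (fun s => (f (trajectory x alpha s))%:E)).
- by move=> s _; exact: kinetic_ge0.
- exact: measurable_kinetic.
- by move=> s _; rewrite lee_fin.
- by apply/measurable_EFinP; exact: measurable_running_cost.
Qed.

Lemma enorm2_trajectory_le_cost x alpha r s (K : R) : admissible alpha ->
  0 <= r <= s -> (finite_horizon_cost f x s alpha <= K%:E)%E ->
  enorm2 (trajectory x alpha r - x) <= 2 * s * K.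
Proof.
move=> aa /andP[r0 rs] hK.
have K0 : 0 <= K by rewrite -lee_fin (le_trans _ hK)// cost_ge0.
have s0 := le_trans r0 rs.
move: r0; rewrite le_eqVlt => /predU1P[r0|r0].
  have -> : trajectory x alpha r - x = 0.
    apply/rowP => i; rewrite /trajectory -r0 !mxE set_itv1 Rintegral_set1.
    by rewrite addr0 subrr.
  by rewrite enorm2_0 !mulr_ge0.
have : ((enorm2 (trajectory x alpha r - x) / (2 * r))%:E <= K%:E)%E.
  apply: le_trans (enorm2_trajectory_le x r0 aa) _; apply: le_trans hK.
  apply: (@le_trans _ _ (\int[mu]_(u in `[0%R, s]) (enorm2 (alpha u) / 2)%:E)%E).
    apply: (@ge0_subset_integral _ _ _ mu _ _ (measurable_itv _) (measurable_itv _)).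
    - exact: measurable_kinetic.
    - by move=> u _; exact: kinetic_ge0.
    - by apply: subset_itvl; rewrite bnd_simp.
  rewrite (costE x s aa); apply: leeDl; apply: integral_ge0 => u _.
  by rewrite lee_fin.
rewrite lee_fin ler_pdivrMr ?mulr_gt0// => h; apply: (le_trans h).
by rewrite mulrC ler_wpM2r// ler_wpM2l.
Qed.

(* The bound [c] on [f] is only needed on the ball which a trajectory of
   almost optimal energy cannot leave before time [s]. *)
Lemma value_ge_step x s t e c : 0 < s -> 0 <= t -> 0 < e ->
  (forall z, enorm2 (z - x) <= 2 * s * (value f x (s + t) + e) -> c <= f z) ->
  exists y, enorm2 (y - x) / (2 * s) + s * c + value f y t <= value f x (s + t) + e.
Proof.
move=> s0 t0 e0 fc; have s0' := ltW s0.
have [alpha aa h] := value_approx cf f_ge0 f_leB x (addr_ge0 s0' t0) e0.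
rewrite (cost_split cf f_ge0 x aa s0' t0) in h.
have hs : (finite_horizon_cost f x s alpha <= (value f x (s + t) + e)%:E)%E.
  by apply: (le_trans _ h); apply: leeDl; exact: cost_ge0.
exists (trajectory x alpha s); rewrite -lee_fin; apply: le_trans h.
rewrite EFinD; apply: leeD; last first.
  by apply: (value_le cf f_ge0 f_leB) => //; exact: admissible_shift.
rewrite (costE x s aa) EFinD; apply: leeD; first exact: enorm2_trajectory_le.
(* For [c <= 0] nonnegativity of [f] suffices; otherwise [c] is a nonnegative integrand and
   monotonicity applies. *)
have [c0|c0] := leP c 0.
  apply: (@le_trans _ _ 0%E); first by rewrite lee_fin mulr_ge0_le0.
  by apply: integral_ge0 => r _; rewrite lee_fin.
apply: (@le_trans _ _ (\int[mu]_(r in `[0%R, s]) (cst c%:E) r)%E).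
  by rewrite integral_cst// [X in (_ <= _ * X)%E](itv_measure0 s0') -EFinM mulrC.
apply: ge0_le_integral => //.
- by move=> r _; rewrite lee_fin ltW.
- by apply/measurable_EFinP; exact: measurable_running_cost.
- move=> r /=; rewrite in_itv/= => rs; rewrite lee_fin fc//.
  exact: enorm2_trajectory_le_cost aa rs hs.
Qed.

End lower_estimates.

(** * Semiconcavity of the value, uniformly in time *)

Section semiconcavity.
Context {R : realType} {n : nat}.
Notation mu := (@lebesgue_measure R).
Implicit Types (s t e c r : R) (x y h : 'rV[R]_n) (alpha : R -> 'rV[R]_n).

Lemma continuous_expRN : continuous (fun r : R => expR (- r)).
Proof.
by move=> r; apply: continuous_comp; [exact: opp_continuous|exact: continuous_expR].
Qed.

Lemma integrable_expRN c t : mu.-integrable `[0, t] (EFin \o (fun r => expR (- r) * c)).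
Proof.
apply: continuous_compact_integrable; first exact: segment_compact.
apply: continuous_subspaceT => r; apply: cvgM; last exact: cvg_cst.
exact: continuous_expRN.
Qed.

(** Velocity of the perturbed path [x(r) + expR (- r) h]. *)
Definition decay alpha h r : 'rV[R]_n := alpha r - expR (- r) *: h.

Lemma admissible_decay alpha h : admissible alpha -> admissible (decay alpha h).
Proof.
move=> aa i T T0; have H := @integrableB _ _ _ mu _ (measurable_itv _) _ _
  (aa i T T0) (integrable_expRN (h ord0 i) T).
apply: eq_integrable H => // r _.
by rewrite /= !mxE EFinB.
Qed.

Lemma trajectory_decay x h alpha r : admissible alpha -> 0 <= r ->
  trajectory (x + h) (decay alpha h) r = trajectory x alpha r + expR (- r) *: h.
Proof.
move=> aa r0; rewrite /trajectory; apply/rowP => i; rewrite !mxE.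
have -> : \int[mu]_(u in `[0, r]) decay alpha h u ord0 i =
    \int[mu]_(u in `[0, r]) (alpha u ord0 i - expR (- u) * h ord0 i).
  by apply: eq_Rintegral => u _; rewrite !mxE.
rewrite (@RintegralB _ _ _ mu _ _ _ (measurable_itv _) (aa i r r0) (integrable_expRN _ r)).
have ie : mu.-integrable `[0, r] (EFin \o (fun u => expR (- u))).
  apply: continuous_compact_integrable; first exact: segment_compact.
  by apply: continuous_subspaceT; exact: continuous_expRN.
rewrite (@RintegralZr _ _ _ mu _ _ _ (measurable_itv _) ie).
have -> : \int[mu]_(u in `[0, r]) expR (- u) = 1 - expR (- r).
  by rewrite /Rintegral integral_expRN_itv0.
by ring.
Qed.

Variables (f : 'rV[R]_n -> R) (B C : R).
Hypotheses (cf : continuous f) (f_ge0 : forall x, 0 <= f x)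
  (f_leB : forall x, f x <= B) (C_ge0 : 0 <= C)
  (scf : forall x h, f (x + h) - 2 * f x + f (x - h) <= C * enorm2 h).

(** By the parallelogram law the kinetic terms exceed those of [alpha] by
    [expR (- r) ^+ 2 * enorm2 h], and semiconcavity bounds the excess of [f] by [C] times the same.
    One factor [expR (- r)] is dropped, since the other already has integral at most 1 over any
    [[0, t]]. *)
Lemma lagrangian_decay x h alpha r : admissible alpha -> 0 <= r ->
  lagrangian f (x + h) (decay alpha h) r +
  lagrangian f (x - h) (decay alpha (- h)) r <=
  2 * lagrangian f x alpha r + expR (- r) * ((1 + C) * enorm2 h).
Proof.
move=> aa r0; rewrite /lagrangian !trajectory_decay// scalerN.
have := scf (trajectory x alpha r) (expR (- r) *: h).
have := enorm2DB (alpha r) (expR (- r) *: h).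
rewrite /decay scalerN opprK !enorm2Z.
have e1 : expR (- r) <= 1 by rewrite expR_le1 oppr_le0.
have e0 := expR_ge0 (- r).
have e2 : expR (- r) ^+ 2 <= expR (- r) by rewrite expr2 ler_piMl.
have : expR (- r) ^+ 2 * enorm2 h * (1 + C) <= expR (- r) * enorm2 h * (1 + C).
  by rewrite ler_wpM2r ?addr_ge0// ler_wpM2r// enorm2_ge0.
by lra.
Qed.

(* Moving the starting point by [h] while damping the displacement like
   [expR (- s)] keeps the semiconcavity constant independent of [t]. *)
Lemma value_semiconcave x h t : 0 <= t ->
  value f (x + h) t + value f (x - h) t <= 2 * value f x t + (1 + C) * enorm2 h.
Proof.
move=> t0; set K := (1 + C) * enorm2 h.
have K0 : 0 <= K by rewrite mulr_ge0 ?addr_ge0 ?enorm2_ge0.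
apply/ler_addgt0Pr => e e0; have e20 : 0 < e / 2 by rewrite divr_gt0.
have [alpha aa H] := value_approx cf f_ge0 f_leB x t0 e20.
have ap := @admissible_decay alpha h aa.
have am := @admissible_decay alpha (- h) aa.
have ml y beta : admissible beta ->
    measurable_fun `[0, t] (fun s => (lagrangian f y beta s)%:E).
  by move=> ab; apply/measurable_EFinP; exact: measurable_lagrangian.
have L0 y beta s : (0 <= (lagrangian f y beta s)%:E)%E.
  by rewrite lee_fin lagrangian_ge0.
have hp := value_le cf f_ge0 f_leB (x + h) t0 ap.
have hm := value_le cf f_ge0 f_leB (x - h) t0 am.
have : (finite_horizon_cost f (x + h) t (decay alpha h) +
    finite_horizon_cost f (x - h) t (decay alpha (- h)) <=
    2%:E * finite_horizon_cost f x t alpha + K%:E)%E.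
  rewrite /finite_horizon_cost -(@ge0_integralD _ _ _ mu _ (measurable_itv _) _ _
    (fun s _ => L0 _ _ s) (ml _ _ ap) (fun s _ => L0 _ _ s) (ml _ _ am)).
  have me : measurable_fun `[0, t] (fun s : R => (expR (- s) * K)%:E).
    by case/integrableP: (integrable_expRN K t).
  apply: (@le_trans _ _ (\int[mu]_(s in `[0%R, t])
      (2%:E * (lagrangian f x alpha s)%:E + (expR (- s) * K)%:E))%E).
    apply: ge0_le_integral => //.
    - by move=> s _; apply: adde_ge0; exact: L0.
    - by apply: emeasurable_funD; [exact: ml|exact: ml].
    - apply: emeasurable_funD => //; apply: measurable_funeM; exact: ml.
    - move=> s /=; rewrite in_itv/= => /andP[s0 _].
      by rewrite -EFinM -!EFinD lee_fin lagrangian_decay.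
  rewrite (@ge0_integralD _ _ _ mu _ (measurable_itv _)
    (fun s => (2%:E * (lagrangian f x alpha s)%:E)%E)
    (fun s => (expR (- s) * K)%:E)) => //; last 3 first.
  - by move=> s _; apply: mule_ge0 => //; rewrite lee_fin.
  - by apply: measurable_funeM; exact: ml.
  - by move=> s _; rewrite lee_fin mulr_ge0// expR_ge0.
  rewrite (@ge0_integralZl_EFin _ _ _ mu _ (measurable_itv _)
    (fun s => (lagrangian f x alpha s)%:E)) => //; last exact: ml.
  apply: leeD2l.
  have := @integral_expRN_itv0 R t t0.
  rewrite (@integralZr _ _ _ mu _ (measurable_itv _) (fun s => (expR (- s))%:E) _ K).
    by move=> ->; rewrite -EFinM lee_fin ler_piMl// gerBl expR_ge0.
  have := integrable_expRN 1 t; apply: eq_integrable => // s _.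
  by rewrite /= mulr1.
move=> H2; have H3 := le_trans (leeD hp hm) H2.
have {}H3 : ((value f (x + h) t)%:E + (value f (x - h) t)%:E <=
  2%:E * (value f x t + e / 2)%:E + K%:E)%E.
  by apply: (le_trans H3); apply: leeD2r; apply: lee_wpmul2l => //; rewrite lee_fin.
move: H3; rewrite -EFinM -!EFinD lee_fin {H H2 hp hm}.
by move: (value f _ _) (value f _ _) (value f _ _) => *; lra.
Qed.

End semiconcavity.

(** * The discounted problem, and the effect of adding a constant to [f] *)

Section discounted.
Context {R : realType} {n : nat}.
Notation mu := (@lebesgue_measure R).
Implicit Types (s t e c r lam T : R) (x y h : 'rV[R]_n) (alpha : R -> 'rV[R]_n).

Lemma measurable_expRN lam (D : set R) : measurable_fun D (fun s : R => expR (- (lam * s))).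
Proof.
apply: measurableT_comp; first exact: measurable_expR.
by apply: measurable_funN; exact: measurable_funM.
Qed.

Variables (f : 'rV[R]_n -> R) (B : R).
Hypotheses (cf : continuous f) (f_ge0 : forall x, 0 <= f x)
  (f_leB : forall x, f x <= B).

Let B_ge0 : 0 <= B. Proof. exact: le_trans (f_ge0 0) (f_leB 0). Qed.

Lemma measurable_discounted lam x alpha : admissible alpha ->
  measurable_fun (`[0, +oo[ : set R)
    (fun s => (lagrangian f x alpha s * expR (- (lam * s)))%:E).
Proof.
move=> aa; apply/measurable_EFinP; apply: measurable_funM.
  by apply: measurable_fun_itvcy => t; exact: measurable_lagrangian.
exact: measurable_expRN.
Qed.

Lemma discounted_lagrangian_ge0 lam x alpha s :
  (0 <= (lagrangian f x alpha s * expR (- (lam * s)))%:E)%E.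
Proof. by rewrite lee_fin mulr_ge0 ?expR_ge0// lagrangian_ge0. Qed.

Lemma discounted_cost_ge lam T x alpha : 0 < lam -> 0 <= T -> admissible alpha ->
  ((expR (- (lam * T)))%:E * finite_horizon_cost f x T alpha <=
   discounted_cost f lam x alpha)%E.
Proof.
move=> lam0 T0 aa.
have md := measurable_discounted lam x aa.
have sT : `[0, T]%classic `<=` (`[0, +oo[%classic : set R).
  by apply: subset_itvl; rewrite bnd_simp.
apply: (@le_trans _ _ (\int[mu]_(s in `[0%R, T])
    (lagrangian f x alpha s * expR (- (lam * s)))%:E)%E); last first.
  apply: (@ge0_subset_integral _ _ _ mu _ _ (measurable_itv _) (measurable_itv _) _ md) => //.
  by move=> s _; exact: discounted_lagrangian_ge0.
have mL : measurable_fun `[0, T] (fun s => (lagrangian f x alpha s)%:E).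
  by apply/measurable_EFinP; exact: measurable_lagrangian.
have L0 s : `[0, T]%classic s -> (0 <= (lagrangian f x alpha s)%:E)%E.
  by move=> _; rewrite lee_fin lagrangian_ge0.
rewrite /finite_horizon_cost.
rewrite -(@ge0_integralZl_EFin _ _ _ mu _ (measurable_itv _) _ L0 mL _ (expR_ge0 _)).
apply: ge0_le_integral => //.
- by move=> s s0T; apply: mule_ge0; [rewrite lee_fin expR_ge0|exact: L0].
- by apply: measurable_funeM.
- by apply: measurable_funS md.
- move=> s /=; rewrite in_itv/= => /andP[s0 sT'].
  rewrite -EFinM lee_fin mulrC ler_wpM2l ?lagrangian_ge0// ler_expR lerN2.
  by rewrite ler_wpM2l// ltW.
Qed.

Lemma discounted_cost_ge0 lam x alpha : (0 <= discounted_cost f lam x alpha)%E.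
Proof. by apply: integral_ge0 => s _; exact: discounted_lagrangian_ge0. Qed.

(** Stopping at time [T] leaves no kinetic cost, so the tail is at most the integral of
    [B * expR (- (lam * s))] from [T] on; before [T] the discount factor is at most 1. *)
Lemma discounted_cost_concat_le lam T x alpha : 0 < lam -> 0 <= T -> admissible alpha ->
  (discounted_cost f lam x (concat T alpha (fun=> 0%R)) <=
   finite_horizon_cost f x T alpha + (B * (expR (- (lam * T)) / lam))%:E)%E.
Proof.
move=> lam0 T0 aa.
have a0 := @admissible_cst R n 0.
have ac := admissible_concat T0 aa a0.
set beta := concat T alpha _ in ac *.
have md := measurable_discounted lam x ac.
have EU : `[0, +oo[%classic = `[0, T[ `|` `[T, +oo[ :> set R.
  by rewrite -itv_bndbnd_setU// bnd_simp.
have dj : [disjoint (`[0, T[%classic : set R) & `[T, +oo[%classic].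
  apply/disj_setPS => r [/=]; rewrite !in_itv/= andbT => /andP[_ rT] Tr.
  by move: rT; rewrite ltNge Tr.
have mdU := md; rewrite EU in mdU.
have -> : discounted_cost f lam x beta =
    (\int[mu]_(s in `[0%R, T[) (lagrangian f x beta s * expR (- (lam * s)))%:E +
     \int[mu]_(s in `[T, +oo[) (lagrangian f x beta s * expR (- (lam * s)))%:E)%E.
  have := @ge0_integral_setU _ _ _ mu _ _ (measurable_itv _) (measurable_itv _) _
    mdU (fun s _ => discounted_lagrangian_ge0 lam x beta s) dj.
  by rewrite -EU; apply.
have mL : measurable_fun `[0, T] (fun s => (lagrangian f x alpha s)%:E).
  by apply/measurable_EFinP; exact: measurable_lagrangian.
have mL' : measurable_fun `[0, T[ (fun s => (lagrangian f x alpha s)%:E).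
  by apply: measurable_funS mL => //; apply: subset_itvl; rewrite bnd_simp.
apply: leeD.
  rewrite /finite_horizon_cost -(@integral_itv_bndo_bndc _ _ _ _ mL').
  apply: ge0_le_integral => //.
  - by move=> s _; exact: discounted_lagrangian_ge0.
  - apply: measurable_funS md => //.
    by apply: subset_itvl; rewrite bnd_simp.
  - move=> s /=; rewrite in_itv/= => /andP[s0 sT].
    rewrite lee_fin; have -> : lagrangian f x beta s = lagrangian f x alpha s.
      by rewrite /lagrangian trajectory_concat ?s0 ?(ltW sT)// /beta /concat sT.
    rewrite ler_piMr ?lagrangian_ge0// -expR0 ler_expR oppr_le0.
    by rewrite mulr_ge0// ltW.
have me : measurable_fun (`[T, +oo[ : set R) (fun s : R => (expR (- (lam * s)))%:E).
  by apply/measurable_EFinP; exact: measurable_expRN.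
rewrite [in leRHS]EFinM -(integral_expRN T lam0).
rewrite -(@ge0_integralZl_EFin _ _ _ mu _ (measurable_itv _)
  (fun s : R => (expR (- (lam * s)))%:E)) => //.
apply: ge0_le_integral => //.
- by move=> s _; exact: discounted_lagrangian_ge0.
- by apply: measurable_funS md => //; apply: subset_itvr; rewrite bnd_simp.
- by apply: measurable_funeM.
- move=> s /=; rewrite in_itv/= andbT => Ts.
  rewrite -EFinM lee_fin ler_wpM2r ?expR_ge0//.
  by rewrite /lagrangian /beta {1}/concat ltNge Ts /= enorm2_0 mul0r add0r.
Qed.

Lemma discounted_cost_fin_num lam x : 0 < lam ->
  ereal_inf (discounted_cost f lam x @` @admissible R n) \is a fin_num.
Proof.
move=> lam0.
apply: (@ereal_inf_fin_numP _ _ 0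
    (0 * (enorm2 (0 : 'rV[R]_n) / 2 + B) + (B * (expR (- (lam * 0)) / lam)))).
  by move=> _ [alpha _ <-]; exact: discounted_cost_ge0.
have a0 := @admissible_cst R n 0.
exists (discounted_cost f lam x (concat 0 (fun=> 0) (fun=> 0))).
  by exists (concat 0 (fun=> 0) (fun=> 0)) => //; exact: admissible_concat.
apply: le_trans (discounted_cost_concat_le x lam0 (lexx 0) a0) _.
rewrite EFinD; apply: leeD2r.
exact: (cost_cst_le cf f_ge0 (lexx 0)).
Qed.

Lemma discounted_value_ge lam T x : 0 < lam -> 0 <= T ->
  expR (- (lam * T)) * value f x T <= discounted_value f lam x.
Proof.
move=> lam0 T0; rewrite -lee_fin fineK ?discounted_cost_fin_num//.
apply: le_ereal_inf_tmp => _ [alpha aa <-].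
apply: le_trans (discounted_cost_ge x lam0 T0 aa); rewrite EFinM.
apply: lee_wpmul2l; first by rewrite lee_fin expR_ge0.
exact: value_le.
Qed.

Lemma discounted_value_le lam T x : 0 < lam -> 0 <= T ->
  discounted_value f lam x <= value f x T + B * (expR (- (lam * T)) / lam).
Proof.
move=> lam0 T0; apply/ler_addgt0Pr => e e0.
have [alpha aa H] := value_approx cf f_ge0 f_leB x T0 e0.
rewrite -lee_fin fineK ?discounted_cost_fin_num//.
have a0 := @admissible_cst R n 0.
apply: (@le_trans _ _ (discounted_cost f lam x (concat T alpha (fun=> 0)))).
  apply: ereal_inf_lbound; exists (concat T alpha (fun=> 0)) => //.
  exact: admissible_concat.
apply: le_trans (discounted_cost_concat_le x lam0 T0 aa) _.
rewrite [X in (_ <= X%:E)%E]addrAC [leRHS]EFinD; exact: leeD2r.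
Qed.

Lemma value_add_cst (m : R) x t : 0 <= t ->
  value (fun y => f y + m) x t = value f x t + m * t.
Proof.
move=> t0.
have costD alpha : admissible alpha ->
    (finite_horizon_cost (fun y => (f y + m)%R) x t alpha =
     finite_horizon_cost f x t alpha + (m * t)%:E)%E.
  move=> aa; have ic : mu.-integrable `[0, t] (EFin \o cst m).
    apply: continuous_compact_integrable; first exact: segment_compact.
    by apply: continuous_subspaceT => u; exact: cvg_cst.
  have := @ge0_integralD_integrable R _ _ _ (measurable_itv _)
    (@measurable_lagrangian _ _ f x alpha t cf aa)
    (fun s _ => lagrangian_ge0 f_ge0 x alpha s) ic.
  rewrite [X in (_ = _ + X)%E -> _](_ : _ = (m * t)%:E); last first.
    apply: etrans (@integral_cst _ _ _ mu _ (measurable_itv _) m%:E) _.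
    by rewrite [X in (_ * X)%E](itv_measure0 t0).
  move=> <-; apply: eq_integral => s _.
  by rewrite /lagrangian /cst addrA.
apply: fine_ereal_infE => [_ [alpha aa <-]|e e0].
  rewrite costD// EFinD; apply: leeD2r; exact: value_le.
have [alpha aa H] := value_approx cf f_ge0 f_leB x t0 e0.
exists (finite_horizon_cost (fun y => f y + m) x t alpha); first by exists alpha.
by rewrite costD// [X in (_ <= X%:E)%E]addrAC [leRHS]EFinD; exact: leeD2r.
Qed.

Lemma discounted_value_add_cst (m : R) lam x : 0 < lam ->
  discounted_value (fun y => f y + m) lam x = discounted_value f lam x + m / lam.
Proof.
move=> lam0.
have ie : mu.-integrable (`[0, +oo[ : set R) (EFin \o (fun s : R => expR (- (lam * s)))).
  apply: ge0_integrable => //; first exact: measurable_expRN.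
  by rewrite (integral_expRN 0 lam0) ltry.
have costD alpha : admissible alpha ->
    (discounted_cost (fun y => (f y + m)%R) lam x alpha =
     discounted_cost f lam x alpha + (m / lam)%:E)%E.
  move=> aa.
  have ic : mu.-integrable (`[0, +oo[ : set R) (EFin \o (fun s : R => m * expR (- (lam * s)))).
    exact: (@integrableZl _ _ _ mu _ (measurable_itv _) m _ ie).
  have ml : measurable_fun (`[0, +oo[ : set R)
      (fun s => lagrangian f x alpha s * expR (- (lam * s))).
    by have /measurable_EFinP := measurable_discounted lam x aa.
  have L0 (s : R) : `[0, +oo[%classic s -> 0 <= lagrangian f x alpha s * expR (- (lam * s)).
    by move=> _; rewrite mulr_ge0 ?expR_ge0// lagrangian_ge0.
  have := @ge0_integralD_integrable R _ _ _ (measurable_itv _) ml L0 ic.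
  rewrite [X in (_ = _ + X)%E -> _](_ : _ = (m / lam)%:E); last first.
    have := @integralZl _ _ _ mu _ (measurable_itv _) _ ie m.
    rewrite [X in (_ = _ * X)%E -> _](integral_expRN 0 lam0) mulr0 oppr0 expR0.
    by rewrite -EFinM div1r; apply.
  move=> <-; apply: eq_integral => s _.
  by rewrite /lagrangian addrA mulrDl.
apply: fine_ereal_infE => [_ [alpha aa <-]|e e0].
  rewrite costD// EFinD; apply: leeD2r.
  rewrite fineK ?discounted_cost_fin_num//; apply: ereal_inf_lbound.
  by exists alpha.
have [_ [alpha aa <-] H] := lb_ereal_inf_adherent e0 (discounted_cost_fin_num x lam0).
exists (discounted_cost (fun y => f y + m) lam x alpha); first by exists alpha.
rewrite costD// [X in (_ <= X%:E)%E]addrAC [leRHS]EFinD; apply: leeD2r.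
by rewrite EFinD fineK ?discounted_cost_fin_num// ltW.
Qed.

End discounted.

(** * Differentials and locally uniform convergence *)

Section locally_uniform.
Context {R : realType} {n : nat}.

(** The hypothesis asks for a common condition on [t] only near each point; the near-covering form
    of compactness merges these conditions over [K]. *)
Lemma family_compact_cvg (I : Type) (F : set_system I) (FF : Filter F)
    (h : I -> 'rV[R]_n -> R) (l : 'rV[R]_n -> R) :
  (forall (e : R) (x : 'rV[R]_n), 0 < e ->
    \forall x' \near x & t \near F, `|l x' - h t x'| < e) ->
  {family compact, h @ F --> l}.
Proof.
move=> H; apply/fam_cvgP => K cK P /uniform_nbhs[E [entE EP]].
move: entE; rewrite -entourage_ballE => -[e e0 eE].
have /(_ I F (fun t x => `|l x - h t x| < e) FF) := (compact_near_coveringP K).1 cK.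
move=> /(_ (fun x _ => H e x e0)); apply: filterS => t ht.
by apply: EP => y Ky; apply: eE; exact: ht.
Qed.

Lemma near_pair_cvg (I : Type) (F : set_system I) (FF : Filter F)
    (h : I -> 'rV[R]_n -> R) (l : 'rV[R]_n -> R) (x : 'rV[R]_n) :
  (forall e : R, 0 < e -> \forall x' \near x & t \near F, `|l x' - h t x'| < e) ->
  h t x @[t --> F] --> l x.
Proof.
move=> H; apply/cvgrPdist_lt => e e0.
have [[P Q] [/= xP FQ PQ]] := H e e0.
apply: filterS FQ => t Qt; apply: (PQ (x, t)); split => //=.
exact: nbhs_singleton.
Qed.

End locally_uniform.

Section differential.
Context {R : realType} {n : nat}.
Implicit Types (phi : 'rV[R]_n -> R) (x h p : 'rV[R]_n).

Definition dot p h : R := \sum_(i < n) p ord0 i * h ord0 i.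

Lemma dotZ p (s : R) h : dot p (s *: h) = s * dot p h.
Proof. by rewrite /dot mulr_sumr; apply: eq_bigr => i _; rewrite mxE mulrCA. Qed.

Lemma dotN p h : dot p (- h) = - dot p h.
Proof. by rewrite -scaleN1r dotZ mulN1r. Qed.

Lemma dotpp p : dot p p = enorm2 p.
Proof. by []. Qed.

Lemma dot_delta p i : dot p (delta_mx ord0 i) = p ord0 i.
Proof.
rewrite /dot (bigD1 i)//= mxE !eqxx mulr1.
by rewrite big1 ?addr0// => j ji; rewrite mxE (negbTE ji) andbF mulr0.
Qed.

(** Completing the square in each coordinate. This is the Fenchel inequality between the Hamiltonian
    [enorm2 p / 2], over a time [s], and the energy of a straight step [h] made in that time. *)
Lemma dot_young p h (s : R) : 0 < s ->
  - dot p h <= s / 2 * enorm2 p + enorm2 h / (2 * s).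
Proof.
move=> s0; rewrite /dot /enorm2 mulr_sumr mulr_suml -sumrN -big_split /=.
apply: ler_sum => i _; set a := p _ _; set b := h _ _.
have s2 : s != 0 by rewrite gt_eqF.
have -> : s / 2 * a ^+ 2 + b ^+ 2 / (2 * s) = - (a * b) + (s * a + b) ^+ 2 / (2 * s).
  by field.
by rewrite lerDl divr_ge0 ?sqr_ge0// mulr_ge0// ltW.
Qed.

Lemma diff_grad phi x h : differentiable phi x -> 'd phi x h = dot (grad phi x) h.
Proof.
move=> dphi; rewrite {1}(row_sum_delta h) linear_sum /=; apply: eq_bigr => i _.
by rewrite linearZ /= mxE deriveE// mulrC.
Qed.

Lemma differentiable_near phi x (e : R) : differentiable phi x -> 0 < e ->
  \forall h \near (0 : 'rV[R]_n), `|phi (x + h) - phi x - dot (grad phi x) h| <= e * `|h|.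
Proof.
move=> dphi e0; have /eqaddoP/(_ e e0) := diff_locally dphi.
apply: filterS => h; rewrite -(diff_grad h dphi) => H.
by apply: le_trans H; rewrite /= !fctE [h + x]addrC opprD addrA.
Qed.

Lemma dot_is_linear p : linear (dot p : 'rV[R]_n -> R^o).
Proof.
move=> c a b; rewrite /dot scaler_sumr -big_split /=; apply: eq_bigr => i _.
by rewrite !mxE mulrDr; congr (_ + _); rewrite mulrCA.
Qed.

HB.instance Definition _ p :=
  GRing.isLinear.Build R 'rV[R]_n R^o *:%R (dot p) (dot_is_linear p).

Lemma continuous_dot p : continuous (dot p : 'rV[R]_n -> R^o).
Proof.
apply: continuous_big => [|i _ h]; first exact: add_continuous.
apply: (@continuous_comp _ _ _ (fun v : 'rV[R]_n => v ord0 i) (fun c : R => p ord0 i * c)).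
  exact: coord_continuous.
exact: mulrl_continuous.
Qed.

Lemma near_differentiable phi x p :
  (forall e : R, 0 < e ->
    \forall h \near (0 : 'rV[R]_n), `|phi (x + h) - phi x - dot p h| <= e * `|h|) ->
  differentiable phi x /\ grad phi x = p.
Proof.
move=> H.
have dxf : (phi : 'rV[R]_n -> R^o) \o shift x =
    cst (phi x : R^o) + (dot p : 'rV[R]_n -> R^o) +o_ (0 : 'rV[R]_n) id.
  apply/eqaddoP => e e0; have := H e e0; apply: filterS => h H'.
  by apply: le_trans H'; rewrite /= !fctE [h + x]addrC opprD addrA.
have E := diff_unique (@continuous_dot p) dxf.
have dphi : differentiable phi x.
  by apply/diff_locallyP; rewrite E; split => //; exact: continuous_dot.
split => //; apply/rowP => i; rewrite mxE deriveE// E; exact: dot_delta.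
Qed.

End differential.

(** * The limit value *)

Section limit_value.
Context {R : realType} {n : nat}.
Implicit Types (s t e c r lam T : R) (x y z h : 'rV[R]_n).

Definition limit_value (f : 'rV[R]_n -> R) x : R :=
  sup [set value f x t | t in [set t | 0 <= t]].

Variables (f : 'rV[R]_n -> R) (B : R) (x0 : 'rV[R]_n).
Hypotheses (cf : continuous f) (f_ge0 : forall x, 0 <= f x)
  (f_leB : forall x, f x <= B) (fx0 : f x0 = 0).

Let B_ge0 : 0 <= B. Proof. exact: le_trans (f_ge0 0) (f_leB 0). Qed.

Lemma value_bounded x t : 0 <= t -> value f x t <= enorm2 (x0 - x) / 2 + B.
Proof.
move=> t0.
(* The trip to [x0] takes unit time, so the horizon is first lengthened by 1; by monotonicity this
   can only increase the value. *)
apply: (@le_trans _ _ (value f x (1 + t))).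
  by apply: le_value; rewrite // t0 lerDr ler01.
have := value_le_cst cf f_ge0 f_leB (x := x) (q := x0 - x) (c := B) ler01 t0.
rewrite scale1r [x + _]addrC subrK mul1r (value_eq0 cf f_ge0 f_leB t0 fx0) addr0.
by apply => r _.
Qed.

Lemma value_has_sup x : has_sup [set value f x t | t in [set t | 0 <= t]].
Proof.
split; first by exists (value f x 0), 0 => //=.
exists (enorm2 (x0 - x) / 2 + B) => _ [t t0 <-]; exact: value_bounded.
Qed.

Lemma value_le_limit x t : 0 <= t -> value f x t <= limit_value f x.
Proof. by move=> t0; apply: (sup_upper_bound (value_has_sup x)); exists t. Qed.

Lemma limit_value_le x c : (forall t, 0 <= t -> value f x t <= c) -> limit_value f x <= c.
Proof.
move=> h; apply: ge_sup; first by exists (value f x 0), 0 => //=.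
by move=> _ [t t0 <-]; exact: h.
Qed.

Lemma limit_value_ge0 x : 0 <= limit_value f x.
Proof. by apply: le_trans (value_le_limit x (lexx 0)); exact: value_ge0. Qed.

Lemma value_near_limit x e : 0 < e ->
  exists2 T, 0 <= T & forall t, T <= t -> limit_value f x - e < value f x t.
Proof.
move=> e0; have [_ [T T0 <-] h] := sup_adherent e0 (value_has_sup x).
exists T; first exact: T0.
move=> t Tt; apply: (lt_le_trans h).
by apply: (le_value cf f_ge0 f_leB); rewrite T0.
Qed.

(** Cost per unit time of moving at sup-norm speed 1: the Euclidean square of such a velocity is at
    most [n], and [f] is at most [B]. *)
Definition lipschitz_cst : R := n%:R / 2 + B.

Lemma lipschitz_cst_ge0 : 0 <= lipschitz_cst.
Proof. by rewrite addr_ge0// divr_ge0. Qed.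

Lemma value_sub_le x y t : 0 <= t ->
  value f x t <= lipschitz_cst * `|x - y| + value f y t.
Proof.
move=> t0; set s := `|x - y|.
have [s0|s0] := eqVneq s 0.
  by rewrite s0 mulr0 add0r; move/normr0_eq0/subr0_eq: s0 => ->.
have sp : 0 < s by rewrite lt_def s0 /s normr_ge0.
have s0' := ltW sp.
apply: (@le_trans _ _ (value f x (s + t))).
  by apply: le_value => //; rewrite t0 lerDr.
have := value_le_cst cf f_ge0 f_leB (x := x) (q := s^-1 *: (y - x)) (c := B) s0' t0.
rewrite scalerA divff// scale1r [x + _]addrC subrK => /(_ (fun r _ => f_leB _)) h.
apply: (le_trans h); rewrite lerD2r mulrC ler_wpM2r// lerD2r ler_wpM2r//.
rewrite enorm2Z exprVn ler_pdivrMl ?exprn_gt0// mulrC.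
by apply: le_trans (enorm2_le_norm _) _; rewrite distrC.
Qed.

Lemma limit_value_sub_le x y :
  limit_value f x <= lipschitz_cst * `|x - y| + limit_value f y.
Proof.
apply: limit_value_le => t t0; apply: le_trans (value_sub_le x y t0) _.
by rewrite lerD2l value_le_limit.
Qed.

Lemma near_norm_lt x (d : R) : 0 < d -> \forall y \near x, `|x - y| < d.
Proof. by move=> d0; apply/nbhs_normP; exists d. Qed.

Lemma continuous_lipschitz_le (g : 'rV[R]_n -> R) (K : R) : 0 <= K ->
  (forall x y, g x <= K * `|x - y| + g y) -> continuous g.
Proof.
move=> K0 gK x; apply/(@cvgrPdist_le _ R^o _ (nbhs x) (nbhs_filter x)) => e e0.
have d0 : 0 < e / (K + 1) by rewrite divr_gt0// ltr_wpDl.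
move: (near_norm_lt x d0); apply: filterS => y /ltW xy.
have : K * `|x - y| <= e.
  apply: le_trans (_ : (K + 1) * `|x - y| <= _); first by rewrite ler_wpM2r// lerDl.
  by rewrite mulrC -ler_pdivlMr// ltr_wpDl.
have := gK x y; have := gK y x; rewrite distrC ler_norml => h1 h2 h3.
by apply/andP; split; lra.
Qed.

Lemma continuous_limit_value : continuous (limit_value f).
Proof. exact: continuous_lipschitz_le lipschitz_cst_ge0 limit_value_sub_le. Qed.

(** One [T] serves a whole neighbourhood of [x] because [value f ^~ t] and the limit share a
    Lipschitz constant independent of [t]: the error is [e / 2] at [x] and [e / 4] for each of the
    two displacements. *)
Lemma value_locally_near_limit x e : 0 < e ->
  exists2 T, 0 <= T & \forall y \near x, forall t, T <= t -> limit_value f y - e < value f y t.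
Proof.
move=> e0; have e40 : 0 < e / 2 by rewrite divr_gt0.
have [T T0 hT] := value_near_limit x e40; exists T => //.
have K0 := lipschitz_cst_ge0.
have d0 : 0 < e / 4 / (lipschitz_cst + 1) by rewrite !divr_gt0// ltr_wpDl.
have := near_norm_lt x d0; apply: filterS => y xy t Tt.
have hK : lipschitz_cst * `|x - y| <= e / 4.
  apply: le_trans (_ : (lipschitz_cst + 1) * `|x - y| <= _); first by rewrite ler_wpM2r// lerDl.
  by rewrite mulrC -ler_pdivlMr ?ltr_wpDl// ltW.
have := hT t Tt; have := value_sub_le x y (le_trans T0 Tt).
have := limit_value_sub_le y x; rewrite distrC; move: hK.
move: (limit_value f y) (limit_value f x) (value f x t) (value f y t).
by move: (lipschitz_cst * _) => k a b c d; lra.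
Qed.

Lemma limit_value_bounded_near x : exists M, \forall y \near x, limit_value f y <= M.
Proof.
exists (limit_value f x + 1).
have := @continuous_limit_value x => /(@cvgrPdist_lt _ R^o _ (nbhs x) (nbhs_filter x)).
move=> /(_ _ ltr01); apply: filterS => y.
by rewrite ltr_distlC => /andP[_ /ltW].
Qed.

Lemma value_cvg_locally x e : 0 < e ->
  \forall x' \near x & t \near +oo, `|limit_value f x' - value f x' t| < e.
Proof.
move=> e0; have [T T0 hT] := value_locally_near_limit x e0.
exists ([set y | forall t, T <= t -> limit_value f y - e < value f y t], [set t | T <= t]).
  by split => //=; exact: (nbhs_pinfty_ge (num_real _)).
move=> [y t] [/= hy Tt]; have := hy t Tt => h.
have h2 := value_le_limit y (le_trans T0 Tt).
rewrite ger0_norm ?subr_ge0//; move: h.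
by move: (limit_value f y) (value f y t) => a b; lra.
Qed.

Lemma value_div_cvg_locally x e : 0 < e ->
  \forall x' \near x & t \near +oo, `|value f x' t / t| < e.
Proof.
move=> e0; have [M hM] := limit_value_bounded_near x.
exists ([set y | limit_value f y <= M], [set t | Num.max 1 (M / e + 1) <= t]).
  by split => //=; exact: (nbhs_pinfty_ge (num_real _)).
move=> [y t] [/= hy]; rewrite ge_max => /andP[t1 tM].
have t0 : 0 < t by apply: lt_le_trans t1.
rewrite ger0_norm ?divr_ge0 ?value_ge0 ?(ltW t0)// ltr_pdivrMr// mulrC.
apply: le_lt_trans (_ : M < _).
  exact: le_trans (value_le_limit _ (ltW t0)) hy.
rewrite -ltr_pdivrMr//; lra.
Qed.

Lemma discounted_value_le_limit lam x : 0 < lam -> discounted_value f lam x <= limit_value f x.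
Proof.
move=> lam0; apply/ler_addgt0Pr => e e0.
(* With [k = lam * T = B / (lam * e)] the tail [B * (expR (- k) / lam)] equals
   [e * (expR (- k) * k)], and [expR k >= 1 + k] makes it at most [e]. *)
pose T := B / (lam ^+ 2 * e).
have T0 : 0 <= T by rewrite divr_ge0// mulr_ge0 ?sqr_ge0// ltW.
apply: le_trans (discounted_value_le cf f_ge0 f_leB x lam0 T0) _.
apply: lerD; first exact: value_le_limit.
have lamT : lam * T = B / (lam * e) by rewrite /T; field; rewrite !gt_eqF.
have le0 : 0 < lam * e by rewrite mulr_gt0.
rewrite lamT; set k := B / (lam * e); set E := expR _.
have E0 : 0 <= E by exact: expR_ge0.
have : E * (1 + k) <= 1.
  by rewrite /E expRN mulrC ler_pdivrMr ?expR_gt0// mul1r; exact: expR_ge1Dx.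
rewrite mulrDr mulr1 => H.
have {}H : E * k <= 1 by lra.
have -> : B * (E / lam) = e * (E * k) by rewrite /k; field; rewrite !gt_eqF.
by rewrite ler_piMr// ltW.
Qed.

Lemma discounted_cvg_locally x e : 0 < e ->
  \forall x' \near x & lam \near 0^'+, `|limit_value f x' - discounted_value f lam x'| < e.
Proof.
move=> e0; have e20 : 0 < e / 2 by rewrite divr_gt0.
have [T T0 hT] := value_locally_near_limit x e20.
have [M hM] := limit_value_bounded_near x.
(* Since [1 - expR (- (lam * T)) <= lam * T], discounting loses at most [lam * T] times the value;
   [lam < d] makes this less than [e / 2]. The added 1s keep the denominator positive. *)
pose d := e / 2 / ((T + 1) * (Num.max M 0 + 1)).
have M0 : 0 <= Num.max M 0 by rewrite le_max lexx orbT.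
have d0 : 0 < d by rewrite !divr_gt0// mulr_gt0// ltr_wpDl.
exists ([set y | (forall t, T <= t -> limit_value f y - e / 2 < value f y t) /\
    limit_value f y <= M],
  [set lam | 0 < lam < d]).
  split => /=; first by apply: filterI.
  near=> lam; apply/andP; split; near: lam; [exact: nbhs_right_gt|exact: nbhs_right_lt].
move=> [y lam] [/= [hy yM] /andP[lam0 lamd]].
have h1 := hy T (lexx T).
have h2 := discounted_value_ge cf f_ge0 f_leB y lam0 T0.
have h3 := discounted_value_le_limit y lam0.
have h4 := value_ge0 f_ge0 y T.
have h5 : 1 - lam * T <= expR (- (lam * T)) by exact: expR_ge1Dx.
have h6 := value_le_limit y T0.
have h7 : (1 - lam * T) * value f y T <= expR (- (lam * T)) * value f y T by rewrite ler_wpM2r.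
have h8 : lam * T * value f y T < e / 2.
  have : lam * ((T + 1) * (Num.max M 0 + 1)) < e / 2.
    by rewrite -ltr_pdivlMr// mulr_gt0// ltr_wpDl.
  apply: le_lt_trans; rewrite -mulrA ler_wpM2l ?(ltW lam0)//.
  apply: ler_pM => //; first by rewrite lerDl.
  apply: le_trans (_ : M <= _); first exact: le_trans h6 yM.
  by apply: le_trans (_ : Num.max M 0 <= _); [rewrite le_max lexx|rewrite lerDl].
rewrite ger0_norm ?subr_ge0//; move: h1 h2 h5 h7 h8 {h3 h6 hT hM hy yM}.
move: (limit_value f y) (value f y T) (discounted_value f lam y) (expR _).
move: (lam * T) => k a b c E h1 h2 h5 h7 h8.
have : k * b < e / 2 -> (1 - k) * b <= c by move=> _; apply: le_trans h2.
by move=> /(_ h8); lra.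
Unshelve. all: by end_near. Qed.

End limit_value.

(** * Viscosity solutions *)

Lemma near_ball0 {R : realType} {n : nat} (x : 'rV[R]_n) (P : 'rV[R]_n -> Prop) :
  (\forall y \near x, P y) ->
  exists2 d : R, 0 < d & forall h, `|h| < d -> P (x + h).
Proof.
move=> /nbhs_normP[d d0 hd]; exists d => // h hh; apply: hd => /=.
by rewrite opprD addrA subrr sub0r normrN.
Qed.

Lemma sqr_le_add1 (R : realFieldType) (a b : R) : a ^+ 2 <= b -> a <= 1 + b.
Proof. by have := sqr_ge0 (a - 1); nra. Qed.

Section viscosity.
Context {R : realType} {n : nat}.
Implicit Types (s t e c r T : R) (x y z h : 'rV[R]_n).
Variables (f : 'rV[R]_n -> R) (B : R) (x0 : 'rV[R]_n).
Hypotheses (cf : continuous f) (f_ge0 : forall x, 0 <= f x)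
  (f_leB : forall x, f x <= B) (fx0 : f x0 = 0).
Notation w := (limit_value f).

Lemma limit_value_le_cst x (q : 'rV[R]_n) s c : 0 <= s ->
  (forall r, 0 <= r <= s -> f (x + r *: q) <= c) ->
  w x <= s * (enorm2 q / 2 + c) + w (x + s *: q).
Proof.
move=> s0 fc; apply: limit_value_le => t t0.
apply: (@le_trans _ _ (value f x (s + t))).
  by apply: (le_value cf f_ge0 f_leB); rewrite t0 lerDr.
apply: le_trans (value_le_cst cf f_ge0 f_leB s0 t0 fc) _.
by apply: lerD => //; exact: (value_le_limit cf f_ge0 f_leB fx0).
Qed.

Lemma coord_itv_compact x (d : R) :
  compact [set y : 'rV[R]_n | forall i, `[x ord0 i - d, x ord0 i + d]%classic (y ord0 i)].
Proof.
apply: (@rV_compact R _ (fun i => `[x ord0 i - d, x ord0 i + d]%classic)) => i.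
exact: segment_compact.
Qed.

Lemma value_unif_near_limit (K : set 'rV[R]_n) e : compact K -> 0 < e ->
  exists2 T, 0 <= T & forall y, K y -> w y - e <= value f y T.
Proof.
move=> cK e0.
have /(_ R (pinfty_nbhs R) (fun t x => `|w x - value f x t| < e) _) :=
  (compact_near_coveringP K).1 cK.
move=> /(_ (fun x _ => value_cvg_locally cf f_ge0 f_leB fx0 x e0)).
move=> [M [_ hM]]; exists (Num.max 0 (M + 1)); first by rewrite le_max lexx.
move=> y Ky; have /hM/(_ y Ky) : M < Num.max 0 (M + 1) by rewrite lt_max ltrDl ltr01 orbT.
rewrite ltr_distlC => /andP[+ _].
by move: (w y) (value f y _) => a b; lra.
Qed.

(** The end point of an almost optimal step depends on the remaining horizon [T], so pointwise
    convergence is not enough. All possible end points lie in one compact box, and [T] is chosen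
    beforehand so that [value f y T] is close to the limit on the whole box. *)
Lemma limit_value_ge_step x s e c : 0 < s -> 0 < e -> 0 <= c ->
  (forall z, enorm2 (z - x) <= 2 * s * (w x + e) -> c <= f z) ->
  exists2 y, enorm2 (y - x) <= 2 * s * (w x + e) &
    enorm2 (y - x) / (2 * s) + s * c + w y <= w x + e.
Proof.
move=> s0 e0 c0 fc; have e20 : 0 < e / 2 by rewrite divr_gt0.
set D := 2 * s * (w x + e) in fc *.
(* The radius [1 + D] avoids a square root: [a ^+ 2 <= D] implies [a <= 1 + D]. *)
have [T T0 hT] := value_unif_near_limit (@coord_itv_compact x (1 + D)) e20.
have vw := value_le_limit cf f_ge0 f_leB fx0 x (addr_ge0 (ltW s0) T0).
have [|y hy] := @value_ge_step _ _ _ _ cf f_ge0 f_leB x s T (e / 2) c s0 T0 e20.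
  move=> z hz; apply: fc; apply: le_trans hz _.
  apply: ler_wpM2l; first by rewrite mulr_ge0// ltW.
  by apply: lerD => //; lra.
have s20 : 0 < 2 * s by rewrite mulr_gt0.
have yD : enorm2 (y - x) <= D.
  have hv := value_ge0 f_ge0 y T.
  have sc : 0 <= s * c by rewrite mulr_ge0// ltW.
  rewrite /D mulrC -ler_pdivrMr//; move: hy vw hv sc.
  by move: (_ / _) (value f y T) (value f x _) (w x) (s * c) => a b c1 d k; lra.
exists y => //.
have Ky : forall i, `[x ord0 i - (1 + D), x ord0 i + (1 + D)]%classic (y ord0 i).
  move=> i /=; rewrite in_itv/=.
  have hi := coord_le_norm (y - x) i; have hn := norm_le_enorm2 (y - x).
  have h := sqr_le_add1 (le_trans hn yD).
  by have := le_trans hi h; rewrite !mxE ler_distl.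
have := hT y Ky; move: hy vw.
by move: (_ / _) (value f y T) (value f x _) (w x) (w y) (s * c) => a b c1 d d' k; lra.
Qed.

(** Leave [x] with velocity [- p] for a short time [s]. Then [phi] drops by about [s * enorm2 p]; at
    a maximum of [w - phi] the function [w] drops at least as much, while dynamic programming allows
    it a drop of at most about [s * (enorm2 p / 2 + f x)]. *)
Lemma limit_value_subsolution (m : R) :
  viscosity_subsolution (fun x p => m + enorm2 p / 2 - (f x + m)) w.
Proof.
move=> phi x [dphi _] hmax; set p := grad phi x.
suff : enorm2 p / 2 <= f x by lra.
apply/ler_addgt0Pr => e e0.
(* Per unit time, the continuity error [k] of [f] and the differentiability error, [k] times the
   norm of [p], add up to [e]. *)
set k := e / (1 + `|p|).
have p1 : 0 < 1 + `|p| by rewrite ltr_pwDl.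
have k0 : 0 < k by rewrite divr_gt0.
have Hd := differentiable_near (dphi x) k0.
have Hf : \forall y \near x, f y <= f x + k.
  have /(@cvgrPdist_lt _ R^o _ (nbhs x) (nbhs_filter x))/(_ _ k0) := cf (x := x).
  by apply: filterS => y; rewrite ltr_distlC => /andP[_ /ltW].
have [d /= d0 hd] : exists2 d : R, 0 < d & forall h, `|h| < d ->
    [/\ `|phi (x + h) - phi x - dot p h| <= k * `|h|, f (x + h) <= f x + k &
     w (x + h) - phi (x + h) <= w x - phi x].
  have [d1 d10 H1] := near_ball0 Hd.
  have [d2 d20 H2] := near_ball0 Hf.
  have [d3 d30 H3] := near_ball0 hmax.
  exists (Num.min d1 (Num.min d2 d3)); first by rewrite !lt_min d10 d20 d30.
  move=> h; rewrite !lt_min => /and3P[h1 h2 h3]; split; [|exact: H2|exact: H3].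
  by have := H1 h h1; rewrite add0r.
pose s := d / 2 / (1 + `|p|).
have s0 : 0 < s by rewrite !divr_gt0.
have sd r : 0 <= r <= s -> `|r *: - p| < d.
  move=> /andP[r0 rs]; rewrite normrZ normrN ger0_norm//.
  have : r * (1 + `|p|) <= d / 2 by rewrite -ler_pdivlMr.
  have := normr_ge0 p; nra.
have ss : 0 <= s <= s by rewrite lexx ltW.
have [h1 _ h3] := hd _ (sd _ ss).
have h2 := limit_value_le_cst (ltW s0) (fun r hr => let: And3 _ H _ := hd _ (sd r hr) in H).
move: h1 h2 h3; rewrite dotZ dotN dotpp normrZ normrN enorm2N gtr0_norm// => h1 h2 h3.
have : s * (enorm2 p / 2) <= s * (f x + k + k * `|p|).
  move: h1 => /ler_normlP[_]; move: h2 h3.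
  by move: (w _) (w _) (phi _) (phi _) (enorm2 p) => a b c1 d1 E h2 h3 h1; nra.
rewrite ler_pM2l// => h; apply: le_trans h _.
have <- : k * (1 + `|p|) = e by rewrite /k divfK// gt_eqF.
by rewrite mulrDr mulr1 addrA.
Qed.

(** Make an almost optimal step of duration [s], ending at [y]. At a minimum of [w - phi], [phi]
    drops from [x] to [y] by at least the cost of the step, up to [k * s]; in the Fenchel inequality
    for [y - x] the energy cancels. The remaining error is [k |y - x|], so [|y - x|] must be of
    order [s], which follows from the Lipschitz bound on [w]. *)
Lemma limit_value_supersolution (m : R) :
  viscosity_supersolution (fun x p => m + enorm2 p / 2 - (f x + m)) w.
Proof.
move=> phi x [dphi _] hmin; set p := grad phi x.
suff : f x <= enorm2 p / 2 by lra.
set K := @lipschitz_cst R n B.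
have K0 : 0 <= K by exact: (lipschitz_cst_ge0 f_ge0 f_leB).
apply/ler_addgt0Pr => e e0.
(* The factor [2 * K + 3] collects [2 * K + 1] from the differentiability error, 1 from the almost
   optimal step and 1 from the continuity of [f]; [k <= 1 / 2] serves the speed bound below. *)
pose k := Num.min (1 / 2) (e / (2 * K + 3)).
have K3 : 0 < 2 * K + 3 by rewrite ltr_wpDl// mulr_ge0.
have k0 : 0 < k by rewrite lt_min !divr_gt0.
have k2 : k <= 1 / 2 by rewrite ge_min lexx.
have ke : k * (2 * K + 3) <= e by rewrite -ler_pdivlMr// ge_min lexx orbT.
clearbody k.
have Hd := differentiable_near (dphi x) k0.
have Hf : \forall y \near x, f x - k <= f y.
  have /(@cvgrPdist_lt _ R^o _ (nbhs x) (nbhs_filter x))/(_ _ k0) := cf (x := x).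
  by apply: filterS => y; rewrite ltr_distlC => /andP[/ltW].
have [d /= d0 hd] : exists2 d : R, 0 < d & forall h, `|h| < d ->
    [/\ `|phi (x + h) - phi x - dot p h| <= k * `|h|, f x - k <= f (x + h) &
     w x - phi x <= w (x + h) - phi (x + h)].
  have [d1 d10 H1] := near_ball0 Hd.
  have [d2 d20 H2] := near_ball0 Hf.
  have [d3 d30 H3] := near_ball0 hmin.
  exists (Num.min d1 (Num.min d2 d3)); first by rewrite !lt_min d10 d20 d30.
  move=> h; rewrite !lt_min => /and3P[h1 h2 h3]; split; [|exact: H2|exact: H3].
  by have := H1 h h1; rewrite add0r.
have w0 : 0 < 4 * (w x + 1) by rewrite mulr_gt0// ltr_wpDl// (limit_value_ge0 cf f_ge0 f_leB fx0).
(* Almost optimal paths then stay within distance [d] of [x], since [2 * s * (w x + k * s) < 4 * s *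
   (w x + 1) <= d ^+ 2]. *)
pose s := Num.min 1 (d ^+ 2 / (4 * (w x + 1))).
have s0 : 0 < s by rewrite lt_min ltr01 divr_gt0// exprn_gt0.
have s1 : s <= 1 by rewrite ge_min lexx.
have sd : s * (4 * (w x + 1)) <= d ^+ 2 by rewrite -ler_pdivlMr// ge_min lexx orbT.
clearbody s.
have ks0 : 0 < k * s by rewrite mulr_gt0.
have small z : enorm2 (z - x) <= 2 * s * (w x + k * s) -> `|z - x| < d.
  move=> hz; have hn := le_trans (norm_le_enorm2 (z - x)) hz.
  rewrite -(@ltr_pXn2r _ 2)// ?nnegrE ?(ltW d0)//.
  apply: le_lt_trans hn _; apply: lt_le_trans sd.
  have := limit_value_ge0 cf f_ge0 f_leB fx0 x.
  by move: (w x) => W W0; nra.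
pose c := Num.max 0 (f x - k).
have c0 : 0 <= c by rewrite le_max lexx.
have [|y hy1 hy2] := @limit_value_ge_step x s (k * s) c s0 ks0 c0.
  move=> z hz; rewrite /c ge_max f_ge0 /=.
  by have [_ + _] := hd _ (small z hz); rewrite [x + _]addrC subrK.
have fc : f x - k <= c by rewrite le_max lexx orbT.
clearbody c.
have [h1 _ h3] := hd _ (small y hy1).
move: h1 h3; rewrite [x + _]addrC subrK => h1 h3.
have yl := limit_value_sub_le cf f_ge0 f_leB fx0 x y.
have y2 := norm_le_enorm2 (y - x).
have hyoung := dot_young p (y - x) s0.
rewrite distrC in yl.
have sn0 : s != 0 by rewrite gt_eqF.
have eE : enorm2 (y - x) = 2 * s * (enorm2 (y - x) / (2 * s)) by field.
rewrite eE in y2.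
have N0 := normr_ge0 (y - x).
move: h1 => /ler_normlP[h1 _]; rewrite -/K in yl.
have E0 : 0 <= enorm2 p by exact: enorm2_ge0.
move: hy2 h1 h3 yl y2 hyoung N0 {hd hmin Hd Hf small eE hy1}.
move: (enorm2 (y - x) / (2 * s)) (`|y - x|) (w x) (w y) (phi x) (phi y) (dot p (y - x)).
move=> Q N a b u v D hy2 h1 h3 yl y2 hyoung N0.
(* Speed bound: [N^2 <= 2 s Q], and the step inequality with the Lipschitz bound gives
   [Q <= K N + k s]. If [N] exceeded [(2 K + 1) s], these and [2 k <= 1] would force [N <= s]. *)
have NC : N <= (2 * K + 1) * s.
  rewrite leNgt; apply/negP => hN.
  have sc : 0 <= s * c by rewrite mulr_ge0// ltW.
  have hQ : Q <= K * N + k * s by lra.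
  have q1 : 2 * s * Q <= 2 * s * (K * N + k * s) by rewrite ler_wpM2l// mulr_ge0// ltW.
  have q2 : N * ((2 * K + 1) * s) <= N * N by rewrite ler_wpM2l// ltW.
  have q3 : s * ((2 * K + 1) * s) < s * N by rewrite ltr_pM2l.
  have q4 : k * (s * s) <= 1 / 2 * (s * s) by rewrite ler_wpM2r// mulr_ge0// ltW.
  have q5 : 0 <= K * (s * s) by rewrite !mulr_ge0// ltW.
  by move: q1 q2 q3 q4 q5 y2; lra.
have main : s * (f x - k) <= s * (enorm2 p / 2 + k * (2 * K + 1) + k).
  have hkN : k * N <= k * ((2 * K + 1) * s) by rewrite ler_pM2l.
  have hsc : s * (f x - k) <= s * c by rewrite ler_pM2l.
  move: (f x) (enorm2 p) hsc hyoung E0 => F P hsc hyoung E0; lra.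
move: main; rewrite ler_pM2l// => main.
by move: (f x) (enorm2 p) main => F P main; lra.
Qed.

End viscosity.

(** * Convex functions *)

Section convexity.
Context {R : realType} {n : nat}.
Implicit Types (F g : 'rV[R]_n -> R) (x y h : 'rV[R]_n).

Definition convex_fun F := forall x h (s : R), 0 <= s <= 1 ->
  F (x + s *: h) <= (1 - s) * F x + s * F (x + h).

Lemma continuous_line F x h : continuous F -> continuous (fun s : R => F (x + s *: h)).
Proof.
move=> cF s; apply: (@continuous_comp _ _ _ (fun s : R => x + s *: h) F); last exact: cF.
by apply: cvgD; [exact: cvg_cst|exact: scalel_continuous].
Qed.

(* A positive maximum of the gap between the graph and its chord would be
   doubled at the reflection of an end point. *)
Lemma midpoint_convex F : continuous F ->
  (forall x h, 2 * F x <= F (x + h) + F (x - h)) -> convex_fun F.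
Proof.
move=> cF mF x h s s01.
pose psi (u : R) := F (x + u *: h) - ((1 - u) * F x + u * F (x + h)).
have psi0 : psi 0 = 0 by rewrite /psi scale0r addr0; ring.
have psi1 : psi 1 = 0 by rewrite /psi scale1r; ring.
have psim u d : 2 * psi u <= psi (u + d) + psi (u - d).
  have := mF (x + u *: h) (d *: h); rewrite /psi !scalerDl scaleNr !addrA.
  by move: (F _) (F _) (F _) (F _) (F _) => a b c a' b'; lra.
have cpsi : continuous psi.
  move=> u; apply: cvgB; first exact: continuous_line.
  apply: cvgD; apply: cvgM; [|exact: cvg_cst|exact: cvg_id|exact: cvg_cst].
  by apply: cvgB; [exact: cvg_cst|exact: cvg_id].
have [c c01 hc] := @EVT_max R psi 0 1 ler01 (continuous_subspaceT cpsi).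
suff : psi c <= 0.
  by move=> h0; rewrite -subr_le0; apply: le_trans h0; apply: hc; rewrite in_itv.
rewrite leNgt; apply/negP => cp.
move: c01; rewrite in_itv/= => /andP[c0 c1].
have [cl|cr] := leP c (1 / 2).
  have := psim c c; rewrite subrr psi0 addr0 => h2.
  have : psi (c + c) <= psi c by apply: hc; rewrite in_itv/=; apply/andP; split; lra.
  by lra.
have := psim c (1 - c); rewrite [c + _]addrC subrK psi1 add0r => h2.
have : psi (c - (1 - c)) <= psi c by apply: hc; rewrite in_itv/=; apply/andP; split; lra.
by lra.
Qed.

(** Convexity compares the difference quotient at a small [s] with the one at 1, and
    differentiability evaluates the former. *)
Lemma convex_grad_le F x h : convex_fun F -> differentiable F x ->
  F x + dot (grad F x) h <= F (x + h).
Proof.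
move=> cF dF; apply/ler_addgt0Pr => e e0.
have h1 : 0 < `|h| + 1 by rewrite ltr_wpDl.
have k0 : 0 < e / (`|h| + 1) by rewrite divr_gt0.
have [d d0 hd] := near_ball0 (differentiable_near dF k0).
pose s := Num.min 1 (d / (`|h| + 1)).
have s0 : 0 < s by rewrite lt_min ltr01 divr_gt0.
have s1 : s <= 1 by rewrite ge_min lexx.
have sd : s * (`|h| + 1) <= d by rewrite -ler_pdivlMr// ge_min lexx orbT.
have : `|s *: h| < d.
  by rewrite normrZ gtr0_norm//; apply: lt_le_trans sd; rewrite ltr_pM2l// ltrDl.
move=> /hd; rewrite add0r dotZ normrZ gtr0_norm// => /ler_normlP[H _].
have H2 : F (x + s *: h) <= (1 - s) * F x + s * F (x + h).
  by apply: cF; rewrite ltW.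
have H3 : e / (`|h| + 1) * (s * `|h|) <= s * e.
  rewrite mulrCA ler_pM2l// mulrAC ler_pdivrMr// ler_pM2l//.
  by rewrite lerDl.
rewrite -(ler_pM2l s0); move: H H2 H3.
move: (F _) (F _) (F _) (dot _ _) (_ / _ * _) => a b c D k; lra.
Qed.

Lemma convex_average F (y : nat -> 'rV[R]_n) k : convex_fun F ->
  F (k.+1%:R^-1 *: \sum_(i < k.+1) y i) <= k.+1%:R^-1 * \sum_(i < k.+1) F (y i).
Proof.
move=> cF; elim: k => [|k IH].
  by rewrite !big_ord_recl !big_ord0 !addr0 invr1 scale1r mul1r.
rewrite big_ord_recr [in leRHS]big_ord_recr /=.
set S := \sum_(i < k.+1) y i in IH *; set T := \sum_(i < k.+1) F (y i) in IH *.
have k0 : k.+1%:R != 0 :> R by rewrite pnatr_eq0.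
have k20 : k.+2%:R != 0 :> R by rewrite pnatr_eq0.
have kE : k.+2%:R = k.+1%:R + 1 :> R by rewrite -natr1.
have -> : k.+2%:R^-1 *: (S + y k.+1) =
    k.+1%:R^-1 *: S + k.+2%:R^-1 *: (y k.+1 - k.+1%:R^-1 *: S).
  rewrite scalerDr scalerBr addrCA addrC; congr (_ + _).
  rewrite scalerA -scalerBl; congr (_ *: _).
  move: k0 k20; rewrite kE; move: (k.+1%:R) => a a0 a1.
  by field; rewrite a0 a1.
have := cF (k.+1%:R^-1 *: S) (y k.+1 - k.+1%:R^-1 *: S) k.+2%:R^-1.
rewrite [_ *: S + (_ - _)]addrC subrK => /(_ _)/le_trans; apply.
  by rewrite invr_ge0 ler0n /= invf_le1// ler1n.
have k2p : 0 < k.+2%:R :> R by rewrite ltr0n.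
rewrite mulrDr lerD2r.
have -> : k.+2%:R^-1 * T = (1 - k.+2%:R^-1) * (k.+1%:R^-1 * T).
  move: k0 k20; rewrite kE; move: (k.+1%:R) => a a0 a1.
  by field; rewrite a0 a1.
by rewrite ler_wpM2l// subr_ge0 invf_le1// ler1n.
Qed.

End convexity.

(** * Differentiability of convex functions *)

Section convex_differentiability.
Context {R : realType} {n : nat}.
Implicit Types (F g : 'rV[R]_n -> R) (x y h v : 'rV[R]_n).

(** Monotonicity of difference quotients along a ray, with denominators cleared so that [a = 0] is
    allowed. *)
Lemma convex_shrink F x v (a b : R) : convex_fun F -> 0 <= a <= b -> 0 < b ->
  b * (F (x + a *: v) - F x) <= a * (F (x + b *: v) - F x).
Proof.
move=> cF /andP[a0 ab] b0; have b1 : b != 0 by rewrite gt_eqF.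
have := cF x (b *: v) (a / b).
rewrite scalerA divfK// divr_ge0 ?(ltW b0)//= ler_pdivrMr// mul1r ab => /(_ isT).
move=> /(ler_wpM2l (ltW b0)).
have : a = a / b * b by rewrite divfK.
move: (a / b) => c ->.
by move: (F _) (F _) (F _) => u w z; lra.
Qed.

(** Left difference quotients never exceed right ones, because [x] lies between [x - b v] and
    [x + a v]. *)
Lemma convex_straddle F x v (a b : R) : convex_fun F -> 0 < a -> 0 < b ->
  0 <= a * (F (x - b *: v) - F x) + b * (F (x + a *: v) - F x).
Proof.
move=> cF a0 b0; have ab0 : 0 < a + b by rewrite addr_gt0.
have ab1 : a + b != 0 by rewrite gt_eqF.
have := cF (x - b *: v) ((a + b) *: v) (b / (a + b)).
rewrite scalerA divfK// subrK divr_ge0 ?(ltW b0) ?(ltW ab0)//=.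
rewrite ler_pdivrMr// mul1r lerDr (ltW a0) => /(_ isT).
have -> : x - b *: v + (a + b) *: v = x + a *: v.
  by rewrite scalerDl [a *: v + _]addrC addrA subrK.
move=> /(ler_wpM2l (ltW ab0)).
have : b / (a + b) * (a + b) = b by rewrite divfK.
move: (b / (a + b)) => c E.
have E2 w z : (a + b) * ((1 - c) * w + c * z) = (a + b) * w + c * (a + b) * (z - w) by ring.
by rewrite E2 E; move: (F _) (F _) (F _) => u w z; lra.
Qed.

(** The slope is the infimum of the right difference quotients, and it dominates the left ones. The
    hypothesis bounds the gap between the two by [e] at a single radius [r]; monotonicity of the
    quotients carries the bound to all smaller steps. *)
Lemma convex_slope F x v : convex_fun F ->
  (forall e : R, 0 < e -> exists2 r : R, 0 < r &
     F (x + r *: v) + F (x - r *: v) - 2 * F x <= e * r) ->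
  exists p : R, forall e : R, 0 < e -> \forall s \near (0 : R),
     `|F (x + s *: v) - F x - p * s| <= e * `|s|.
Proof.
move=> cF good.
pose phi (s : R) := F (x + s *: v) - F x.
have st a b : 0 < a -> 0 < b -> 0 <= a * phi (- b) + b * phi a.
  by move=> a0 b0; rewrite /phi scaleNr; exact: convex_straddle.
have shp a b : 0 <= a <= b -> 0 < b -> b * phi a <= a * phi b.
  exact: convex_shrink.
have shn a b : 0 <= a <= b -> 0 < b -> b * phi (- a) <= a * phi (- b).
  move=> ab b0; have := @convex_shrink F x (- v) a b cF ab b0.
  by rewrite /phi !scalerN !scaleNr.
pose S := [set phi r / r | r in [set r : R | 0 < r]].
have S0 : S !=set0 by exists (phi 1 / 1), 1 => //=.
have lbS b : 0 < b -> lbound S (- (phi (- b) / b)).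
  move=> b0 _ [r /= r0 <-]; rewrite -mulNr ler_pdivrMr// mulrAC ler_pdivlMr//.
  by have := st r b r0 b0; lra.
have infS : has_inf S by split => //; exists (- (phi (- 1) / 1)); exact: lbS.
pose p := inf S.
have pr r : 0 < r -> p * r <= phi r.
  move=> r0; rewrite -ler_pdivlMr//; apply: (ge_inf infS.2); by exists r.
have pb b : 0 < b -> - (p * b) <= phi (- b).
  move=> b0; rewrite lerNl -ler_pdivrMr// mulNr; exact: lb_le_inf S0 (lbS b b0).
exists p => e e0; have [r0 r0p hr] := good e e0.
have hr' : phi r0 + phi (- r0) <= e * r0.
  by rewrite /phi scaleNr; move: hr; move: (F _) (F _) (F _) => a b c; lra.
have main s : `|s| < r0 -> `|phi s - p * s| <= e * `|s|.
  move=> sr; have [s0|s0|->] := ltrgtP s 0; last first.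
  - by rewrite /phi scale0r addr0 subrr mulr0 subrr normr0 mulr0.
  - have sr0 : s < r0 by move: sr; rewrite gtr0_norm.
    rewrite (gtr0_norm s0) ger0_norm ?subr_ge0 ?pr//.
    have /= h1 := shp s r0 _ r0p; rewrite (ltW s0) (ltW sr0) in h1.
    have h2 := h1 isT; have h3 := pb r0 r0p.
    rewrite -(ler_pM2l r0p).
    have : s * phi r0 <= s * (e * r0 + p * r0) by rewrite ler_pM2l//; lra.
    by lra.
  - have sr0 : - s < r0 by move: sr; rewrite ltr0_norm.
    have s0' : 0 < - s by rewrite oppr_gt0.
    have /= h1 := shn (- s) r0 _ r0p; rewrite (ltW s0') (ltW sr0) opprK in h1.
    have h2 := h1 isT; have h3 := pr r0 r0p.
    have h4 := pb _ s0'; rewrite opprK mulrN opprK in h4.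
    rewrite (ltr0_norm s0) ger0_norm ?subr_ge0//.
    rewrite -(ler_pM2l r0p).
    have : - s * phi (- r0) <= - s * (e * r0 - p * r0) by rewrite ler_pM2l//; lra.
    by lra.
apply/nbhs_normP; exists r0 => // s sr; apply: main.
by move: sr; rewrite /ball_ /= sub0r normrN.
Qed.

Lemma norm_le_coord x (d : R) : 0 <= d -> (forall i, `|x ord0 i| <= d) -> `|x| <= d.
Proof.
move=> d0 h; rewrite /Num.norm/= mx_normrE; apply/bigmax_leP; split => // -[i j] _.
by rewrite /= (ord1 i).
Qed.

End convex_differentiability.

(** For a convex function partial derivatives suffice. The point [x + h] is the average of the [n]
    points [x + n h_i e_i], so Jensen's inequality bounds [F (x + h)] above by the linear expansion;
    the lower bound follows from the upper one at [x - h], because [x] is the midpoint of the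
    two. *)
Lemma convex_differentiable (R : realType) (n : nat) (F : 'rV[R]_n -> R) (x : 'rV[R]_n) :
  (0 < n)%N -> convex_fun F ->
  (forall (i : 'I_n) (e : R), 0 < e -> exists2 r : R, 0 < r &
     F (x + r *: delta_mx ord0 i) + F (x - r *: delta_mx ord0 i) - 2 * F x <= e * r) ->
  differentiable F x.
Proof.
case: n F x => // m F x _ cF good.
have /choice[q hq] : forall i : 'I_m.+1, exists p : R, forall e : R, 0 < e ->
   \forall s \near (0 : R), `|F (x + s *: delta_mx ord0 i) - F x - p * s| <= e * `|s|.
  by move=> i; apply: convex_slope => // e; exact: good.
pose p := \row_i q i : 'rV[R]_m.+1.
suff [] : differentiable F x /\ grad F x = p by [].
apply: near_differentiable => e e0.
pose N : R := m.+1%:R.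
have N0 : 0 < N by rewrite ltr0n.
have N1 : N != 0 by rewrite gt_eqF.
have eN : 0 < e / N by rewrite divr_gt0.
have W : \forall s \near (0 : R), forall i : 'I_m.+1,
    `|F (x + s *: delta_mx ord0 i) - F x - q i * s| <= e / N * `|s|.
  apply: (@filter_forall R 'I_m.+1 (fun i s =>
    `|F (x + s *: delta_mx ord0 i) - F x - q i * s| <= e / N * `|s| : Prop)
    (nbhs (0 : R)) (nbhs_filter _)) => i.
  exact: hq.
have /nbhs_normP[d /= d0 hd] := W.
have up h : `|h| < d / N -> F (x + h) <= F x + dot p h + e * `|h|.
  move=> hh; have H i : `|F (x + (N * h ord0 i) *: delta_mx ord0 i) - F x -
      q i * (N * h ord0 i)| <= e / N * `|N * h ord0 i|.
    apply: hd; rewrite /ball_ /= sub0r normrN normrM (gtr0_norm N0) mulrC -ltr_pdivlMr//.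
    exact: le_lt_trans (coord_le_norm h i) hh.
  pose y (k : nat) : 'rV[R]_m.+1 := x + (N * h ord0 (inord k)) *: delta_mx ord0 (inord k).
  have := convex_average y m cF.
  have -> : m.+1%:R^-1 *: \sum_(i < m.+1) y i = x + h.
    rewrite big_split /= sumr_const card_ord -[x *+ _]scaler_nat scalerDr scalerA mulVf// scale1r.
    congr (_ + _); rewrite [RHS]row_sum_delta scaler_sumr; apply: eq_bigr => i _.
    by rewrite inord_val scalerA mulrA mulVf// mul1r.
  move/le_trans; apply; rewrite mulrC ler_pdivrMr//.
  apply: (@le_trans _ _ (\sum_(i < m.+1) (F x + q i * (N * h ord0 i) + e * `|h|))).
    apply: ler_sum => i _; rewrite /y inord_val.
    have := H i; rewrite normrM (gtr0_norm N0) [e / N * _]mulrA divfK// => /ler_normlP[_].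
    have : e * `|h ord0 i| <= e * `|h| by rewrite ler_pM2l// coord_le_norm.
    by move: (e * _) (e * _) (F _) (F _) (q i * _) => u w a b c; lra.
  rewrite !big_split /= !sumr_const card_ord -[F x *+ _]mulr_natr -[_ * `|h| *+ _]mulr_natr.
  have -> : \sum_(i < m.+1) q i * (N * h ord0 i) = dot p h * N.
    by rewrite /dot mulr_suml; apply: eq_bigr => i _; rewrite mxE; ring.
  by rewrite /N; lra.
apply/nbhs_normP; exists (d / N); rewrite /= ?divr_gt0// => h; rewrite /ball_ /= sub0r normrN => hh.
apply/ler_normlP; split; last by have := up h hh; lra.
have := up (- h); rewrite normrN => /(_ hh); rewrite dotN.
have := cF (x - h) (2 *: h) (1 / 2).
rewrite scalerA divfK ?pnatr_eq0// scale1r subrK.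
have -> : x - h + 2 *: h = x + h by rewrite scaler_nat mulr2n addrA subrK.
move=> /(_ _).
have -> : 0 <= (1 / 2 : R) <= 1 by apply/andP; split; lra.
move=> /(_ isT).
by move: (F _) (F _) (F _) (dot _ _) => a b c D; lra.
Qed.

(** * Null sets *)

Section null_sets.
Context {R : realType} {n : nat}.
Implicit Types (a b : nat -> 'rV[R]_n) (N : set 'rV[R]_n).

Lemma subset_lebesgue_null N N' : N `<=` N' -> lebesgue_null N' -> lebesgue_null N.
Proof.
move=> NN' h e e0; have [a [b [ab cov le]]] := h e e0; exists a, b; split => //.
exact: subset_trans NN' cov.
Qed.

Lemma box_volume_ge0 a b : (forall k i, a k ord0 i <= b k ord0 i) ->
  forall k, (0%:E <= (\prod_(i < n) (b k ord0 i - a k ord0 i))%:E)%E.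
Proof. by move=> ab k; rewrite lee_fin prodr_ge0// => i _; rewrite subr_ge0. Qed.

Lemma lebesgue_null_bigcup (N_ : nat -> set 'rV[R]_n) :
  (forall k, lebesgue_null (N_ k)) -> lebesgue_null (\bigcup_k N_ k).
Proof.
move=> nullN e e0.
pose P k (ab : (nat -> 'rV[R]_n) * (nat -> 'rV[R]_n)) :=
  [/\ forall j i, ab.1 j ord0 i <= ab.2 j ord0 i,
      N_ k `<=` \bigcup_j [set x | forall i, ab.1 j ord0 i <= x ord0 i <= ab.2 j ord0 i] &
      (\sum_(0 <= j <oo) (\prod_(i < n) (ab.2 j ord0 i - ab.1 j ord0 i))%:E
           <= (e / (2 ^ k.+1)%:R)%:E)%E].
have [G PG] : {G : nat -> (nat -> 'rV[R]_n) * (nat -> 'rV[R]_n) & forall k, P k (G k)}.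
  apply: (@choice _ _ P) => k.
  have ek : 0 < e / (2 ^ k.+1)%:R by rewrite divr_gt0// ltr0n expn_gt0.
  by have [a [b H]] := nullN k _ ek; exists (a, b).
(* A bijection of [nat] with pairs lists all boxes in one sequence; the volumes are then regrouped
   as a double sum, row [k] contributing at most [e / 2 ^ k.+1]. *)
have /card_esym/ppcard_eqP[f] := card_nat2.
pose V (p : nat * nat) := (\prod_(i < n) ((G p.1).2 p.2 ord0 i - (G p.1).1 p.2 ord0 i))%:E.
have V0 p : (0 <= V p)%E.
  by have [h _ _] := PG p.1; exact: (box_volume_ge0 h).
exists (fun c => (G (f c).1).1 (f c).2), (fun c => (G (f c).1).2 (f c).2); split.
- by move=> c i; have [h _ _] := PG (f c).1; exact: h.
- move=> x [k _ Nkx]; have [_ cov _] := PG k.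
  have [j _ hx] := cov x Nkx; exists (f^-1%FUN (k, j)) => //=.
  by rewrite invK ?inE.
rewrite [leLHS](_ : _ = (\sum_(0 <= c <oo) (V \o f) c)%E)//.
rewrite nneseries_esumT//; last by move=> c; exact: V0.
rewrite -(@reindex_esum _ _ _ setT setT f V)//.
have -> : (\esum_(p in setT) V p = \esum_(k in setT) \esum_(j in setT) V (k, j))%E.
  rewrite (@esum_esum _ _ _ setT (fun=> setT) (fun k j => V (k, j)))//.
  by congr esum; first [by apply/funext => -[]|by apply/seteqP; split].
apply: le_trans (epsilon_trick0 xpredT (ltW e0)).
rewrite -nneseries_esumT; last by move=> k; exact: esum_ge0.
apply: lee_nneseries => [k _ _|k _]; first by apply: esum_ge0 => j _; exact: V0.
by rewrite -nneseries_esumT//; have [_ _] := PG k.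
Qed.

Lemma lebesgue_null_cubes N : (0 < n)%N ->
  (forall e : R, 0 < e -> exists (I : finType) (P : pred I) (a : I -> 'rV[R]_n) (d : R),
    [/\ 0 <= d,
        forall x, N x -> exists2 i, P i & forall j, a i ord0 j <= x ord0 j <= a i ord0 j + d &
        #|P|%:R * d ^+ n <= e]) ->
  lebesgue_null N.
Proof.
move=> n0 H e e0; have [I [P [a [d [d0 cov vol]]]]] := H e e0.
pose s := [seq a i | i <- enum P].
have ss : size s = #|P| by rewrite size_map -cardE.
pose A k := nth 0 s k.
(* The finite family is padded by degenerate boxes [A k = B k], whose volume is 0 because [0 < n]
   makes the product nonempty. *)
pose B k := if (k < size s)%N then A k + const_mx d else A k.
have AB k j : B k ord0 j - A k ord0 j = if (k < size s)%N then d else 0.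
  rewrite /B; case: ifP => _; last by rewrite subrr.
  by rewrite !mxE addrAC subrr add0r.
have ABle k i : A k ord0 i <= B k ord0 i.
  by rewrite -subr_ge0 AB; case: ifP.
exists A, B; split => //.
- move=> x /cov[i Pi hx]; exists (index (a i) s) => //=.
  have ais : a i \in s by apply/mapP; exists i => //; rewrite mem_enum.
  move=> j; have := hx j; rewrite /B index_mem ais /A nth_index//.
  by rewrite !mxE.
apply: (@le_trans _ _ (#|P|%:R * d ^+ n)%:E); last by rewrite lee_fin.
apply: lime_le; first by apply: is_cvg_nneseries => k _ _; exact: box_volume_ge0.
near=> m; have sm : (size s <= m)%N by near: m; exact: nbhs_infty_ge.
rewrite (big_cat_nat (leq0n _) sm)/= [X in (_ + X)%E]big1_seq ?adde0; last first.
  move=> k /= /[!mem_index_iota] /andP[sk _].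
  by rewrite (bigD1 (Ordinal n0))//= AB ltnNge sk /= mul0r.
rewrite big_nat (eq_bigr (fun=> (d ^+ n)%:E)); last first.
  move=> k /andP[_ ks]; congr EFin; rewrite (eq_bigr (fun=> d)) => [|j _].
    by rewrite prodr_const card_ord.
  by rewrite AB ks.
rewrite -big_nat sumEFin lee_fin big_const_nat subn0 ss iter_addr_0 mulr_natl lexx.
by [].
Unshelve. all: by end_near. Qed.

End null_sets.

(** Each summand is [d l - d (A + l)] for the increments [d l = psi (l + A) - psi l]. The two
    windows of length [N] differ only at their ends, leaving two windows of length [A] whatever [N]
    is. *)
Lemma second_difference_sum (R : realType) (psi : nat -> R) (A N : nat) (L : R) :
  (forall l, `|psi (l + A)%N - psi l| <= L) ->
  \sum_(l < N) (2 * psi (l + A)%N - psi (l + A + A)%N - psi l) <= 2 * A%:R * L.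
Proof.
move=> hL; pose d l := psi (l + A)%N - psi l.
have E : \sum_(l < N) d l + \sum_(l < A) d (N + l)%N =
    \sum_(l < A) d l + \sum_(l < N) d (A + l)%N.
  have H a b : \sum_(l < a + b) d l = \sum_(l < a) d l + \sum_(l < b) d (a + l)%N.
    by rewrite big_split_ord.
  by rewrite -H addnC H.
have -> : \sum_(l < N) (2 * psi (l + A)%N - psi (l + A + A)%N - psi l) =
    \sum_(l < N) d l - \sum_(l < N) d (A + l)%N.
  rewrite -sumrB; apply: eq_bigr => l _.
  by rewrite /d [(A + l)%N]addnC; ring.
have -> : \sum_(l < N) d l - \sum_(l < N) d (A + l)%N =
    \sum_(l < A) d l - \sum_(l < A) d (N + l)%N.
  by move: E; move: (\sum_(_ < _) _) (\sum_(_ < _) _) (\sum_(_ < _) _) (\sum_(_ < _) _) => *; lra.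
rewrite -sumrB.
have -> : 2 * A%:R * L = \sum_(l < A) (L + L).
  by rewrite sumr_const card_ord -[in RHS]mulr_natr; ring.
apply: ler_sum => l _; have /ler_normlP[_ h1] := hL l.
have /ler_normlP[h2 _] := hL (N + l)%N.
by rewrite /d; lra.
Qed.

Lemma grid_index (R : realType) (M d y : R) (N : nat) : 0 < d -> d * N.+1%:R = 2 * M ->
  `|y| <= M -> exists l : 'I_N.+1, - M + l%:R * d <= y <= - M + l%:R * d + d.
Proof.
move=> d0 dN; rewrite ler_norml => /andP[y1 y2].
pose x := (y + M) / d.
have x0 : 0 <= x by rewrite divr_ge0 ?(ltW d0)//; lra.
have yE : y = - M + x * d by rewrite /x divfK ?gt_eqF//; ring.
have /andP[t1 t2] := truncn_itv x0.
have dD (a : R) : a * d + d = (a + 1) * d by ring.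
have [lt|ge] := ltnP (Num.truncn x) N.+1.
  exists (Ordinal lt) => /=; rewrite yE lerD2l ler_pM2r// t1 /=.
  by rewrite -addrA lerD2l dD ler_pM2r// natr1 ltW.
(* Here [y = M], where the truncation is one too large; the point lies in the last closed cell. *)
have xN : N.+1%:R <= x by apply: le_trans t1; rewrite ler_nat.
have xN2 : x * d <= N.+1%:R * d by rewrite mulrC in dN; lra.
exists ord_max => /=; rewrite yE -addrA !lerD2l dD natr1 xN2 andbT.
by rewrite ler_pM2r//; apply: le_trans xN; rewrite ler_nat.
Qed.

(** Counts the grid lines parallel to the axis [i]: each is represented by the index function that
    is 0 in that coordinate. *)
Lemma card_ffun_fix (n N : nat) (i : 'I_n) :
  #|[pred f : {ffun 'I_n -> 'I_N.+1} | f i == ord0]| = (N.+1 ^ n.-1)%N.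
Proof.
pose F (j : 'I_n) : pred 'I_N.+1 := if j == i then pred1 ord0 else predT.
rewrite (eq_card (B := family F)); last first.
  move=> f; rewrite inE; apply/eqP/familyP => [fi j|/(_ i)].
    by rewrite /F; case: eqP => [->|//]; rewrite inE fi.
  by rewrite /F eqxx inE => /eqP.
rewrite card_family foldrE big_map big_enum /= (bigD1 i)//= /F eqxx card1 mul1n.
rewrite (eq_bigr (fun=> N.+1)) => [|j /negbTE ->]; last by rewrite card_ord.
rewrite prod_nat_const; congr (_ ^ _)%N.
by rewrite cardC1 card_ord.
Qed.

(** * Kinks of semiconcave functions along coordinate axes *)

Section kinks.
Context {R : realType} {n : nat}.
Variables (g : 'rV[R]_n -> R) (C K : R).
Hypotheses (C_ge0 : 0 <= C) (K_ge0 : 0 <= K)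
  (scg : forall x h, g (x + h) - 2 * g x + g (x - h) <= C * enorm2 h)
  (lipg : forall x y, g x <= K * `|x - y| + g y).

Lemma lipschitz_dist x y : `|g x - g y| <= K * `|x - y|.
Proof. by have := lipg x y; have := lipg y x; rewrite distrC ler_distl; lra. Qed.

(** The second difference at scale [r] along axis [i] of the convex function
    [C / 2 * enorm2 y - g y]. A kink at [x] shows as a value of at least [eps * r] at all scales. *)
Definition curvature (i : 'I_n) (r : R) x : R :=
  C * r ^+ 2 - (g (x + r *: delta_mx ord0 i) - 2 * g x + g (x - r *: delta_mx ord0 i)).

Lemma enorm2_delta (i : 'I_n) : enorm2 (delta_mx ord0 i : 'rV[R]_n) = 1.
Proof. by rewrite -dotpp dot_delta mxE !eqxx. Qed.

Lemma curvature_ge0 i r x : 0 <= curvature i r x.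
Proof.
by rewrite subr_ge0; have := scg x (r *: delta_mx ord0 i); rewrite enorm2Z enorm2_delta mulr1.
Qed.

(** Moves the evaluation from a kink to a nearby grid node at a loss independent of [r]. The factor
    4 is the sum 1 + 2 + 1 of the weights. *)
Lemma curvature_lipschitz i r x y : curvature i r x <= curvature i r y + 4 * K * `|x - y|.
Proof.
rewrite /curvature; set v := r *: delta_mx ord0 i.
have := lipschitz_dist (x + v) (y + v); have := lipschitz_dist (x - v) (y - v).
have := lipschitz_dist x y.
have E w : x + w - (y + w) = x - y by rewrite opprD addrACA subrr addr0.
rewrite !E => /ler_normlP[a1 a2] /ler_normlP[b1 b2] /ler_normlP[c1 c2].
move: a1 a2 b1 b2 c1 c2; move: (g _) (g _) (g _) (g _) (g _) (g _) (`|x - y|) (C * _).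
by move=> *; lra.
Qed.

(** For fixed total length [N d] the sum is of order [d]: the [N] quadratic terms give
    [N C (A d)^2], and the second differences of the [K]-Lipschitz [g] telescope to at most
    [2 A K A d]. *)
Lemma curvature_sum i x (A N : nat) (d : R) : 0 <= d ->
  \sum_(l < N) curvature i (A%:R * d) (x + (l%:R * d) *: delta_mx ord0 i) <=
  d * (A%:R ^+ 2 * (N%:R * d * C + 2 * K)).
Proof.
move=> d0; set v : 'rV[R]_n := delta_mx ord0 i.
(* The shift by [A] makes the nodes [psi (l + A)] and their left neighbours [psi l], with no
   negative index. *)
pose psi (k : nat) := g (x + ((k%:R - A%:R) * d) *: v).
have vn : `|v| <= 1.
  apply: norm_le_coord => // j; rewrite mxE eqxx /=.
  by case: (_ == _); rewrite ?normr1 ?normr0.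
have hpsi l : `|psi (l + A)%N - psi l| <= K * (A%:R * d).
  apply: le_trans (lipschitz_dist _ _) _; rewrite ler_wpM2l//.
  rewrite opprD addrACA subrr add0r -scalerBl normrZ.
  have -> : ((l + A)%N%:R - A%:R) * d - (l%:R - A%:R) * d = A%:R * d by rewrite natrD; ring.
  by rewrite ger0_norm ?mulr_ge0// ler_piMr// mulr_ge0.
have h := second_difference_sum N hpsi.
rewrite (eq_bigr (fun l : 'I_N => C * (A%:R * d) ^+ 2 +
    (2 * psi (l + A)%N - psi (l + A + A)%N - psi l))) => [|l _]; last first.
  rewrite /curvature /psi -/v; congr (_ + _).
  have -> : x + (l%:R * d) *: v + (A%:R * d) *: v = x + (((l + A + A)%N%:R - A%:R) * d) *: v.
    by rewrite -addrA -scalerDl; congr (_ + _ *: _); rewrite !natrD; ring.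
  have -> : x + (l%:R * d) *: v - (A%:R * d) *: v = x + ((l%:R - A%:R) * d) *: v.
    by rewrite -addrA -scalerBl; congr (_ + _ *: _); ring.
  have -> : x + (l%:R * d) *: v = x + (((l + A)%N%:R - A%:R) * d) *: v.
    by congr (_ + _ *: _); rewrite !natrD; ring.
  by ring.
rewrite big_split /= sumr_const card_ord -[_ *+ N]mulr_natr.
have -> : d * (A%:R ^+ 2 * (N%:R * d * C + 2 * K)) =
    C * (A%:R * d) ^+ 2 * N%:R + 2 * A%:R * (K * (A%:R * d)) by ring.
by rewrite lerD2l.
Qed.

End kinks.

Section kink_sets.
Context {R : realType} {n : nat}.
Variables (g : 'rV[R]_n -> R) (C K : R).
Hypotheses (n_gt0 : (0 < n)%N) (C_ge0 : 0 <= C) (K_ge0 : 0 <= K)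
  (scg : forall x h, g (x + h) - 2 * g x + g (x - h) <= C * enorm2 h)
  (lipg : forall x y, g x <= K * `|x - y| + g y).

(* On each line of a grid of mesh [d], second differences of [g] at the scale
   [A * d] are [O(d)] in total, while each cell meeting a kink contributes at
   least [d]: a bounded number of cells per line meet the kinks. *)
Lemma kinks_null (i : 'I_n) (eps M : R) : 0 < eps -> 0 < M ->
  lebesgue_null [set x : 'rV[R]_n | (forall j, `|x ord0 j| <= M) /\
    forall r : R, 0 < r -> eps * r <= curvature g C i r x].
Proof.
move=> eps0 M0; apply: lebesgue_null_cubes => // e e0.
have K40 : 0 <= (4 * K + 1) / eps by rewrite divr_ge0 ?(ltW eps0)// addr_ge0// mulr_ge0.
(* A kink has curvature at least [eps * A * d] at scale [A * d]; this [A] leaves at least [d] at the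
   node after the loss [4 * K * d]. *)
set A := Num.bound ((4 * K + 1) / eps).
have A1 : (4 * K + 1) / eps < A%:R by exact: archi_boundP.
have A0 : 0 < A%:R :> R by apply: le_lt_trans A1.
have Aeps : 4 * K + 1 < eps * A%:R by rewrite [eps * _]mulrC -ltr_pdivrMr.
clearbody A.
pose Q := A%:R ^+ 2 * (2 * M * C + 2 * K).
have Q0 : 0 <= Q by rewrite mulr_ge0 ?sqr_ge0// addr_ge0// !mulr_ge0// ltW.
have V0 : 0 <= Q * (2 * M) ^+ n / e.
  by rewrite divr_ge0 ?(ltW e0)// mulr_ge0// exprn_ge0// mulr_ge0// ltW.
(* At most [N.+1 ^ n.-1 * Q] cubes of side [2 * M / N.+1] will be used, of total volume at most
   [Q (2 M)^n / N.+1], which is below [e] for this [N]. *)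
set N := Num.bound (Q * (2 * M) ^+ n / e).
have N1 : Q * (2 * M) ^+ n / e < N%:R by exact: archi_boundP.
clearbody N.
have NS : (0 : R) < N.+1%:R by rewrite ltr0n.
pose d := 2 * M / N.+1%:R.
have d0 : 0 < d by rewrite divr_gt0// mulr_gt0.
have dN : d * N.+1%:R = 2 * M by rewrite divfK// gt_eqF.
pose z0 (f : {ffun 'I_n -> 'I_N.+1}) : 'rV[R]_n :=
  \row_j (- M + (if j == i then 0 else (f j)%:R) * d).
pose z (p : {ffun 'I_n -> 'I_N.+1} * 'I_N.+1) := z0 p.1 + (p.2%:R * d) *: delta_mx ord0 i.
have zE p j : z p ord0 j = - M + (if j == i then p.2%:R else (p.1 j)%:R) * d.
  rewrite !mxE eqxx /= mulr_natr; case: eqP => _; last by rewrite mulr0n addr0.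
  by rewrite mulr1n mul0r addr0.
pose r := A%:R * d.
have r0 : 0 < r by rewrite mulr_gt0.
(* A node is a line, given by [p.1] with coordinate [i] frozen at 0, and a position [p.2] on it;
   freezing avoids counting each node [N.+1] times. *)
pose P (p : {ffun 'I_n -> 'I_N.+1} * 'I_N.+1) := (p.1 i == ord0) && (d <= curvature g C i r (z p)).
exists ({ffun 'I_n -> 'I_N.+1} * 'I_N.+1)%type, P, z, d; split; first exact: ltW.
- move=> x [xM xk].
  have /choice[l hl] : forall j : 'I_n, exists l : 'I_N.+1,
      - M + l%:R * d <= x ord0 j <= - M + l%:R * d + d.
    by move=> j; exact: grid_index.
  pose p : {ffun 'I_n -> 'I_N.+1} * 'I_N.+1 := ([ffun j => if j == i then ord0 else l j], l i).
  have hx j : z p ord0 j <= x ord0 j <= z p ord0 j + d.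
    by rewrite zE /p /= ffunE; have := hl j; case: (eqVneq j i) => [->|].
  exists p => //; rewrite /P /p /= ffunE !eqxx /= -/p.
  have xz : `|x - z p| <= d.
    apply: norm_le_coord => [|j]; first exact: ltW.
    by have := hx j; rewrite !mxE ler_distl => /andP[h1 h2]; apply/andP; split; lra.
  have h1 := curvature_lipschitz C lipg i r x (z p).
  have h2 := xk r r0.
  have h3 : 4 * K * `|x - z p| <= 4 * K * d by rewrite ler_wpM2l// mulr_ge0.
  have h4 : (4 * K + 1) * d <= eps * A%:R * d by rewrite ler_pM2r// ltW.
  move: h1 h2 h3 h4; rewrite /r; move: (curvature _ _ _ _ _) (curvature _ _ _ _ _) => a b.
  by move=> *; lra.
have count : #|P|%:R * d <= N.+1%:R ^+ n.-1 * (d * Q).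
  rewrite -sum1_card natr_sum mulr_suml.
  apply: (@le_trans _ _ (\sum_(p | P p) curvature g C i r (z p))).
    by apply: ler_sum => p /andP[_ h]; rewrite mul1r.
  apply: (@le_trans _ _ (\sum_(f : {ffun 'I_n -> 'I_N.+1} | f i == ord0)
      \sum_(l < N.+1) curvature g C i r (z (f, l)))).
    rewrite pair_big_dep /= big_mkcond [leRHS]big_mkcond /=.
    apply: ler_sum => -[f l] _ /=; rewrite /P /= andbT.
    case: (f i == ord0) => //=; case: ifP => // _; exact: curvature_ge0.
  apply: (@le_trans _ _ (\sum_(f : {ffun 'I_n -> 'I_N.+1} | f i == ord0) (d * Q))).
    apply: ler_sum => f _.
    have := curvature_sum C K_ge0 lipg i (z0 f) A N.+1 (ltW d0).
    by rewrite [N.+1%:R * d]mulrC dN.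
  rewrite sumr_const (eq_card (B := [pred f : {ffun 'I_n -> 'I_N.+1} | f i == ord0]))//.
  by rewrite card_ffun_fix -[leLHS]mulr_natl natrX.
have count' : #|P|%:R <= N.+1%:R ^+ n.-1 * Q.
  by rewrite -(ler_pM2r d0) -mulrA [Q * d]mulrC.
apply: (@le_trans _ _ (N.+1%:R ^+ n.-1 * Q * d ^+ n)).
  by rewrite ler_wpM2r// exprn_ge0// ltW.
have -> : N.+1%:R ^+ n.-1 * Q * d ^+ n = Q * (2 * M) ^+ n / N.+1%:R.
  have N1' : N.+1%:R != 0 :> R by rewrite gt_eqF.
  rewrite /d expr_div_n; move: N1'; move: (N.+1%:R : R) => a a0.
  have -> : a ^+ n = a ^+ n.-1 * a by rewrite -exprSr prednK.
  by field; rewrite a0 expf_neq0.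
rewrite ler_pdivrMr// [e * _]mulrC -ler_pdivrMr//.
by apply: (le_trans (ltW N1)); rewrite ler_nat.
Qed.

Lemma no_kink_differentiable x : convex_fun (fun y => C / 2 * enorm2 y - g y) ->
  (forall (i : 'I_n) (e : R), 0 < e -> exists2 r : R, 0 < r & curvature g C i r x <= e * r) ->
  differentiable (fun y => C / 2 * enorm2 y - g y) x.
Proof.
move=> cF good; apply: convex_differentiable => // i e e0.
have [r r0 hr] := good i e e0; exists r => //; apply: le_trans hr.
have := enorm2DB x (r *: delta_mx ord0 i); rewrite enorm2Z enorm2_delta mulr1 /curvature => E.
have -> : enorm2 (x + r *: delta_mx ord0 i) =
  2 * enorm2 x + 2 * r ^+ 2 - enorm2 (x - r *: delta_mx ord0 i) by lra.
by lra.
Qed.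

End kink_sets.

(** * Semiconcave functions *)

Section semiconcave_functions.
Context {R : realType} {n : nat}.
Implicit Types (g : 'rV[R]_n -> R) (x h : 'rV[R]_n).

Lemma enorm2D x h : enorm2 (x + h) = enorm2 x + 2 * dot x h + enorm2 h.
Proof.
rewrite /enorm2 /dot mulr_sumr -!big_split /=; apply: eq_bigr => i _.
by rewrite mxE; ring.
Qed.

Lemma differentiable_sub_quad g (c : R) x : differentiable g x ->
  differentiable (fun y => c * enorm2 y - g y) x /\
  grad (fun y => c * enorm2 y - g y) x = (2 * c) *: x - grad g x.
Proof.
move=> dg; apply: near_differentiable => e e0.
have e20 : 0 < e / 2 by rewrite divr_gt0.
have [d d0 hd] := near_ball0 (differentiable_near dg e20).
pose k := `|c| * n%:R + 1.
have k0 : 0 < k by rewrite ltr_wpDl// mulr_ge0.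
have d'0 : 0 < Num.min d (e / 2 / k) by rewrite lt_min d0 divr_gt0.
apply/nbhs_normP; exists (Num.min d (e / 2 / k)) => // h.
rewrite /ball_ /= sub0r normrN lt_min => /andP[hd1 hd2].
have := hd h hd1; rewrite add0r => H.
have -> : c * enorm2 (x + h) - g (x + h) - (c * enorm2 x - g x) -
    dot ((2 * c) *: x - grad g x) h =
    c * enorm2 h - (g (x + h) - g x - dot (grad g x) h).
  have -> : dot ((2 * c) *: x - grad g x) h = 2 * c * dot x h - dot (grad g x) h.
    rewrite /dot mulr_sumr -sumrB; apply: eq_bigr => i _.
    by rewrite !mxE; ring.
  by rewrite enorm2D; ring.
apply: le_trans (ler_normB _ _) _.
suff : `|c * enorm2 h| <= e / 2 * `|h| by move: H; lra.
rewrite normrM (ger0_norm (enorm2_ge0 h)).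
apply: (@le_trans _ _ (k * `|h| * `|h|)).
  apply: (@le_trans _ _ (`|c| * (n%:R * `|h| ^+ 2))); first by rewrite ler_wpM2l// enorm2_le_norm.
  have := sqr_ge0 `|h|; rewrite /k; lra.
rewrite ler_wpM2r//; move: hd2; rewrite ltr_pdivlMr// mulrC => /ltW.
by [].
Qed.

Lemma differentiable_add_cst g (c : R) x : differentiable g x ->
  differentiable (fun y => g y + c) x /\ grad (fun y => g y + c) x = grad g x.
Proof.
move=> dg; apply: near_differentiable => e e0.
apply: filterS (differentiable_near dg e0) => h.
by rewrite opprD addrACA subrr addr0.
Qed.

Lemma continuous_enorm2 : continuous (@enorm2 R n).
Proof.
apply: continuous_big => [|i _ h]; first exact: add_continuous.
apply: (@continuous_comp _ _ _ (fun v : 'rV[R]_n => v ord0 i) (fun c : R => c ^+ 2)).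
  exact: coord_continuous.
exact: exprn_continuous.
Qed.

Lemma semiconcave_gap_convex g (C : R) : continuous g ->
  (forall x h, g (x + h) - 2 * g x + g (x - h) <= C * enorm2 h) ->
  convex_fun (fun y => C / 2 * enorm2 y - g y).
Proof.
move=> cg scg.
have c1 : continuous (fun y : 'rV[R]_n => C / 2 * enorm2 y).
  move=> y; apply: (@continuous_comp _ _ _ (@enorm2 R n) (fun c : R => C / 2 * c)).
    exact: continuous_enorm2.
  exact: mulrl_continuous.
apply: midpoint_convex => [y|x h]; first exact: (@continuousB _ R^o _ _ _ y (c1 y) (cg y)).
have := scg x h; have := enorm2DB x h => E.
have -> : enorm2 (x + h) = 2 * enorm2 x + 2 * enorm2 h - enorm2 (x - h) by lra.
by lra.
Qed.

Lemma semiconcave_ae_differentiable g (C K : R) : (0 < n)%N -> 0 <= C -> 0 <= K ->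
  (forall x h, g (x + h) - 2 * g x + g (x - h) <= C * enorm2 h) ->
  (forall x y, g x <= K * `|x - y| + g y) ->
  almost_everywhere_Rn (fun x => differentiable g x).
Proof.
move=> n0 C0 K0 scg lipg.
have cg : continuous g by exact: continuous_lipschitz_le K0 lipg.
have cF := semiconcave_gap_convex cg scg.
(* Countably many kink sets: [k] modulo [n] names an axis, and [m.+1] serves both as the size of the
   box and as the inverse of the kink threshold. *)
pose E (k m : nat) := [set x : 'rV[R]_n | (forall j, `|x ord0 j| <= m.+1%:R) /\
    forall r : R, 0 < r -> m.+1%:R^-1 * r <= curvature g C (Ordinal (ltn_pmod k n0)) r x].
apply: (@subset_lebesgue_null _ _ _ (\bigcup_k \bigcup_m E k m)); last first.
  apply: lebesgue_null_bigcup => k; apply: lebesgue_null_bigcup => m.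
  by apply: (kinks_null n0 C0 K0 scg lipg); rewrite ?invr_gt0 ltr0n.
move=> x ndx; apply: contrapT => nE; apply: ndx.
have [|dG _] := @differentiable_sub_quad (fun y => C / 2 * enorm2 y - g y) (C / 2) x.
  apply: no_kink_differentiable => // i e e0; apply: contrapT => bad; apply: nE.
  have kink r : 0 < r -> e * r < curvature g C i r x.
    by move=> r0; rewrite ltNge; apply/negP => h; apply: bad; exists r.
  pose m := (Num.bound e^-1 + Num.bound `|x|)%N.
  exists (val i) => //; exists m => //; split=> [j|r r0].
    apply: le_trans (coord_le_norm x j) _.
    apply: le_trans (ltW (archi_boundP (normr_ge0 x))) _.
    by rewrite ler_nat leqW// leq_addl.
  have -> : Ordinal (ltn_pmod (val i) n0) = i by apply: val_inj; rewrite /= modn_small.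
  apply: le_trans (ltW (kink r r0)); rewrite ler_pM2r//.
  rewrite invf_ple ?posrE ?ltr0n//.
  apply: le_trans (ltW (archi_boundP _)) _; first by rewrite invr_ge0 ltW.
  by rewrite ler_nat leqW// leq_addr.
by have <- : (fun y => C / 2 * enorm2 y - (C / 2 * enorm2 y - g y)) = g
  by apply/funext => y; rewrite subKr.
Qed.

(** For a convex function the partial derivatives at [x] lie between the left and right difference
    quotients at a fixed scale [r]. Those of [w t] converge to those of [l], which are close to
    [grad l x] when [r] is small. *)
Lemma convex_grad_cvg (T : Type) (F : set_system T) (FF : Filter F)
    (w : T -> 'rV[R]_n -> R) (l : 'rV[R]_n -> R) x :
  (\forall t \near F, convex_fun (w t) /\ differentiable (w t) x) ->
  differentiable l x ->
  (forall y, w t y @[t --> F] --> l y) ->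
  grad (w t) x @[t --> F] --> grad l x.
Proof.
move=> cw dl wl; apply/cvg_ballP => e e0.
suff H (i : 'I_n) : \forall t \near F, `|grad l x ord0 i - grad (w t) x ord0 i| < e.
  have := @filter_forall T 'I_n
    (fun i t => `|grad l x ord0 i - grad (w t) x ord0 i| < e : Prop) F FF H.
  by apply: filterS => t h; split => // j i; rewrite (ord1 j); exact: h.
(* One quarter pays for the difference quotient of [l], and two for replacing [w t] by [l] at [x]
   and at a neighbour [x + r v] or [x - r v]. *)
pose e' := e / 4.
have e'0 : 0 < e' by rewrite divr_gt0.
have [d d0 hd] := near_ball0 (differentiable_near dl e'0).
pose r := d / 2.
have r0 : 0 < r by rewrite divr_gt0.
set v : 'rV[R]_n := delta_mx ord0 i.
have vn : `|v| <= 1.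
  apply: norm_le_coord => // j; rewrite mxE eqxx /=.
  by case: (_ == _); rewrite ?normr1 ?normr0.
have rv : `|r *: v| <= r by rewrite normrZ gtr0_norm// ler_piMr// ltW.
have rd : r < d by rewrite /r; lra.
have lp : `|l (x + r *: v) - l x - r * grad l x ord0 i| <= e' * r.
  have := hd (r *: v) (le_lt_trans rv rd); rewrite add0r dotZ dot_delta => h.
  by apply: (le_trans h); rewrite ler_wpM2l// ltW.
have ln : `|l (x - r *: v) - l x + r * grad l x ord0 i| <= e' * r.
  have := hd (- (r *: v)); rewrite normrN => /(_ (le_lt_trans rv rd)).
  rewrite add0r dotN dotZ dot_delta opprK => h.
  by apply: (le_trans h); rewrite normrN ler_wpM2l// ltW.
have er0 : 0 < e' * r by rewrite mulr_gt0.
have near_w y : \forall t \near F, `|l y - w t y| < e' * r.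
  have := wl y => /(@cvgrPdist_lt _ R^o _ F FF). exact.
have n1 := near_w x; have n2 := near_w (x + r *: v); have n3 := near_w (x - r *: v).
near=> t.
have [cwt dwt] : convex_fun (w t) /\ differentiable (w t) x by near: t.
have := convex_grad_le (r *: v) cwt dwt; have := convex_grad_le (- (r *: v)) cwt dwt.
rewrite dotN dotZ dot_delta.
have : `|l x - w t x| < e' * r by near: t.
have : `|l (x + r *: v) - w t (x + r *: v)| < e' * r by near: t.
have : `|l (x - r *: v) - w t (x - r *: v)| < e' * r by near: t.
rewrite !ltr_distlC => /andP[a1 a2] /andP[b1 b2] /andP[c1 c2] p1 p2.
move: lp ln => /ler_normlP[l1 l2] /ler_normlP[l3 l4].
have eE : e * r = 4 * (e' * r) by rewrite /e'; field.
rewrite -(ltr_pM2l r0) -[X in _ && X](ltr_pM2l r0).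
move: a1 a2 b1 b2 c1 c2 p1 p2 l1 l2 l3 l4.
move: (w t x) (w t _) (w t _) (l x) (l _) (l _) (grad l x ord0 i) (grad _ _ _ _).
by move=> *; apply/andP; split; lra.
Unshelve. all: by end_near. Qed.

End semiconcave_functions.

(** * The theorem *)

Section normalized.
Context {R : realType} {n : nat}.
Variables (f : 'rV[R]_n -> R) (B m : R) (x0 : 'rV[R]_n).
Hypotheses (cf : continuous f) (f_ge0 : forall x, 0 <= f x)
  (f_leB : forall x, f x <= B) (fx0 : f x0 = 0).
Let F x := f x + m.
Hypothesis minF : fmin F = m.

Lemma limit_value_semiconcave (C : R) : 0 <= C ->
  (forall x h, f (x + h) - 2 * f x + f (x - h) <= C * enorm2 h) ->
  forall x h, limit_value f (x + h) - 2 * limit_value f x + limit_value f (x - h) <=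
    (1 + C) * enorm2 h.
Proof.
move=> C0 scf x h; apply/ler_addgt0Pr => e e0.
have e20 : 0 < e / 2 by rewrite divr_gt0.
have [T1 T10 h1] := value_near_limit cf f_ge0 f_leB fx0 (x + h) e20.
have [T2 T20 h2] := value_near_limit cf f_ge0 f_leB fx0 (x - h) e20.
pose T := Num.max T1 T2.
have T0 : 0 <= T by rewrite le_max T10.
have H1 := h1 T; have H2 := h2 T; rewrite !le_max !lexx orbT in H1 H2.
have {}H1 := H1 isT; have {}H2 := H2 isT.
have H3 := value_le_limit cf f_ge0 f_leB fx0 x T0.
have H4 := value_semiconcave cf f_ge0 f_leB C0 scf x h T0.
move: H1 H2 H3 H4 {h1 h2}.
move: (limit_value f _) (limit_value f _) (limit_value f _).
move: (value f _ _) (value f _ _) (value f _ _).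
by move=> *; lra.
Qed.

Lemma discounted_cvg (e : R) (x : 'rV[R]_n) : 0 < e ->
  \forall x' \near x & lam \near 0^'+,
    `|limit_value f x' - (discounted_value F lam x' - fmin F / lam)| < e.
Proof.
move=> e0; have [[P Q] [/= xP FQ PQ]] := discounted_cvg_locally cf f_ge0 f_leB fx0 x e0.
exists (P, Q `&` [set lam | 0 < lam]).
  by split => //=; apply: filterI => //; exact: nbhs_right_gt.
move=> [y lam] [/= Py [Qlam lam0]].
rewrite (discounted_value_add_cst cf f_ge0 f_leB m y lam0) minF addrK.
exact: (PQ (y, lam)).
Qed.

Lemma ergodic_limitE : ergodic_limit F = limit_value f.
Proof.
apply/funext => x; apply: (@cvg_lim R^o) => //.
apply: (@near_pair_cvg _ _ R (0^'+) _
  (fun lam y => discounted_value F lam y - fmin F / lam) (limit_value f) x) => e e0.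
exact: discounted_cvg.
Qed.

Lemma value_cvg (e : R) (x : 'rV[R]_n) : 0 < e ->
  \forall x' \near x & t \near +oo, `|limit_value f x' - (value F x' t - m * t)| < e.
Proof.
move=> e0; have [[P Q] [/= xP FQ PQ]] := value_cvg_locally cf f_ge0 f_leB fx0 x e0.
exists (P, Q `&` [set t | 0 <= t]).
  by split => //=; apply: filterI => //; exact: (nbhs_pinfty_ge (num_real _)).
move=> [y t] [/= Py [Qt t0]].
rewrite (value_add_cst cf f_ge0 f_leB m y t0) addrK.
exact: (PQ (y, t)).
Qed.

Lemma value_div_cvg (e : R) (x : 'rV[R]_n) : 0 < e ->
  \forall x' \near x & t \near +oo, `|m - value F x' t / t| < e.
Proof.
move=> e0; have [[P Q] [/= xP FQ PQ]] := value_div_cvg_locally cf f_ge0 f_leB fx0 x e0.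
exists (P, Q `&` [set t | 0 < t]).
  by split => //=; apply: filterI => //; exact: (nbhs_pinfty_gt (num_real _)).
move=> [y t] [/= Py [Qt t0]].
rewrite (value_add_cst cf f_ge0 f_leB m y (ltW t0)) mulrDl mulfK ?gt_eqF//.
rewrite opprD addrCA subrr addr0 normrN.
exact: (PQ (y, t)).
Qed.

Lemma viscosity_solution_limit :
  viscosity_solution (fun x p => m + enorm2 p / 2 - F x) (limit_value f).
Proof.
split.
- exact: (@continuous_limit_value _ _ f B x0).
- exact: (limit_value_subsolution cf f_ge0 f_leB fx0).
- exact: (limit_value_supersolution cf f_ge0 f_leB fx0).
Qed.

Lemma valueF (t : R) : 0 <= t -> value F ^~ t = (fun x => value f x t + m * t).
Proof. by move=> t0; apply/funext => x; exact: (value_add_cst cf f_ge0 f_leB). Qed.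

Lemma differentiable_valueF (t : R) (x : 'rV[R]_n) : 0 <= t ->
  differentiable (value F ^~ t) x ->
  differentiable (value f ^~ t) x /\ grad (value F ^~ t) x = grad (value f ^~ t) x.
Proof.
move=> t0; rewrite valueF// => /(@differentiable_add_cst _ _ _ (- (m * t)))[].
rewrite (_ : (fun y => _ + - (m * t)) = value f ^~ t).
  by move=> d <-.
by apply/funext => y; rewrite addrK.
Qed.

Variable C : R.
Hypotheses (n_gt0 : (0 < n)%N) (C_ge0 : 0 <= C)
  (scf : forall x h, f (x + h) - 2 * f x + f (x - h) <= C * enorm2 h).

Let C1_ge0 : 0 <= 1 + C. Proof. exact: addr_ge0. Qed.
Let K_ge0 := @lipschitz_cst_ge0 R n f B f_ge0 f_leB.

Lemma value_second_difference_le t x h : 0 <= t ->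
  value f (x + h) t - 2 * value f x t + value f (x - h) t <= (1 + C) * enorm2 h.
Proof.
move=> t0; have := value_semiconcave cf f_ge0 f_leB C_ge0 scf x h t0.
by move: (value _ _ _) (value _ _ _) (value _ _ _) => *; lra.
Qed.

Lemma value_ae_differentiable (t : R) : 0 <= t ->
  almost_everywhere_Rn (fun x => differentiable (value F ^~ t) x).
Proof.
move=> t0.
have := @semiconcave_ae_differentiable R n (value f ^~ t) (1 + C) _ n_gt0 C1_ge0 K_ge0.
move=> /(_ (fun x h => value_second_difference_le x h t0)).
move=> /(_ (fun x y => value_sub_le cf f_ge0 f_leB x y t0)).
apply: subset_lebesgue_null => x /= nd d; apply: nd.
by rewrite valueF//; have [] := differentiable_add_cst (m * t) d.
Qed.

(** At other times [grad] need not be a gradient, hence the restricted filter. Subtracting the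
    values from a quadratic independent of [t] makes them convex, and the quadratic is removed after
    the limit. *)
Lemma grad_value_cvg (x : 'rV[R]_n) : differentiable (limit_value f) x ->
  grad (value F ^~ t) x @[t --> within
    [set t | differentiable (value F ^~ t) x] (nbhs +oo)] --> grad (limit_value f) x.
Proof.
move=> dl; set c := (1 + C) / 2.
have lipl := limit_value_sub_le cf f_ge0 f_leB fx0.
have cl := continuous_limit_value cf f_ge0 f_leB fx0.
have [dl' gl] := differentiable_sub_quad c dl.
set D := [set t | _].
have H : grad (fun y => c * enorm2 y - value f y t) x @[t --> within D (nbhs +oo)] -->
    grad (fun y => c * enorm2 y - limit_value f y) x.
  apply: convex_grad_cvg => //.
  - apply: filterS (nbhs_pinfty_ge (num_real (0 : R))) => t t0 Dt; split.
      apply: semiconcave_gap_convex => [|y h]; last exact: value_second_difference_le.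
      exact: continuous_lipschitz_le K_ge0 (fun x y => value_sub_le cf f_ge0 f_leB x y t0).
    by have [] := differentiable_sub_quad c (differentiable_valueF t0 Dt).1.
  - move=> y; apply: cvgB; first exact: cvg_cst.
    apply: cvg_within_filter.
    apply: (@near_pair_cvg _ _ R +oo _ (fun t y => value f y t) (limit_value f) y) => e e0.
    exact: (value_cvg_locally cf f_ge0 f_leB fx0).
have : (2 * c) *: x - grad (fun y => c * enorm2 y - value f y t) x @[t --> within D (nbhs +oo)] -->
    (2 * c) *: x - grad (fun y => c * enorm2 y - limit_value f y) x.
  by apply: cvgB; first exact: cvg_cst.
rewrite gl subKr; apply: cvg_trans; apply: near_eq_cvg.
apply: filterS (nbhs_pinfty_ge (num_real (0 : R))) => t t0 Dt.
have [d ->] := differentiable_valueF t0 Dt.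
by have [_ ->] := differentiable_sub_quad c d; rewrite subKr.
Qed.

End normalized.

Theorem theorem2p2 (R : realType) (n : nat) (n_gt0 : (0 < n)%N)
    (f : 'rV[R]_n -> R)
    (f_cont : continuous f)
    (f_bounded : exists B : R, forall x, `|f x| <= B)
    (f_attains_min : exists x0, forall x, f x0 <= f x) :
  let u := value f in
  let v := ergodic_limit f in
  [/\ (* specification of v: locally uniform limit of the discounted problems,
         and viscosity solution of the ergodic equation *)
      {family compact,
         (fun (lambda : R) x => discounted_value f lambda x - fmin f / lambda)
           @ 0^'+ --> v} /\
      viscosity_solution (fun x p => fmin f + enorm2 p / 2 - f x) v,
      {family compact,
         (fun (t : R) x => u x t / t) @ +oo --> (fun=> fmin f)},
      {family compact,
         (fun (t : R) x => u x t - fmin f * t) @ +oo --> v} &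
      forall C2 : R, lipschitz f -> semiconcave C2 f ->
        (* D_x u(., t) exists almost everywhere for each t, and, for almost
           every x, D_x u(x, t) --> Dv(x) along the times t at which
           D_x u(x, t) exists *)
        (forall t : R, 0 < t ->
           almost_everywhere_Rn (fun x => differentiable (u ^~ t) x)) /\
        almost_everywhere_Rn (fun x =>
          differentiable v x /\
          grad (u ^~ t) x @[t --> within
            [set t | differentiable (u ^~ t) x] (nbhs +oo)] --> grad v x)].
Proof.
have [B fB] := f_bounded; have [x0 fx0] := f_attains_min.
set m := fmin f.
have mE : m = f x0.
  have lb : lbound (range f) (f x0) by move=> _ [x _ <-].
  apply/eqP; rewrite eq_le; apply/andP; split.
    by apply: ge_inf; [exists (f x0)|exists x0].
  by apply: lb_le_inf => //; exists (f x0), x0.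
pose l x := f x - m.
have ccst : continuous ((fun=> m) : 'rV[R]_n -> R) by exact: cst_continuous.
have cl : continuous l.
  by move=> x; exact: (@continuousB _ R^o _ _ _ x (f_cont x) (ccst x)).
have l_ge0 x : 0 <= l x by rewrite subr_ge0 mE.
have l_leB x : l x <= B - m by rewrite lerD2r (le_trans (ler_norm _)).
have lx0 : l x0 = 0 by rewrite /l mE subrr.
have fE : f = (fun x => l x + m) by apply/funext => x; rewrite subrK.
have minF : fmin (fun x => l x + m) = m by rewrite -fE.
clearbody l m.
rewrite fE /= (ergodic_limitE cl l_ge0 l_leB lx0 minF); split.
- split; last exact: (viscosity_solution_limit m cl l_ge0 l_leB lx0).
  apply: family_compact_cvg => e x e0.
  by have := discounted_cvg cl l_ge0 l_leB lx0 minF x e0; rewrite minF.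
- by apply: family_compact_cvg => e x e0; exact: (value_div_cvg m cl l_ge0 l_leB lx0).
- by apply: family_compact_cvg => e x e0; exact: (value_cvg m cl l_ge0 l_leB lx0).
move=> C2 _ [_ scF].
(* The constant [C2] may be negative, while the estimates ask for a nonnegative one. *)
have scl x h : l (x + h) - 2 * l x + l (x - h) <= `|C2| * enorm2 h.
  apply: (@le_trans _ _ (C2 * enorm2 h)); last by rewrite ler_wpM2r ?enorm2_ge0// ler_norm.
  by have := scF x h; lra.
split=> [t t0|].
  exact: (value_ae_differentiable m cl l_ge0 l_leB n_gt0 (normr_ge0 C2) scl (ltW t0)).
have K0 := @lipschitz_cst_ge0 R n l (B - m) l_ge0 l_leB.
have := @semiconcave_ae_differentiable R n (limit_value l) (1 + `|C2|) _ n_gt0 _ K0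
  (limit_value_semiconcave cl l_ge0 l_leB lx0 (normr_ge0 C2) scl)
  (limit_value_sub_le cl l_ge0 l_leB lx0).
move=> /(_ (addr_ge0 ler01 (normr_ge0 C2))).
apply: subset_lebesgue_null => x /= nd d; apply: nd; split => //.
exact: (grad_value_cvg m cl l_ge0 l_leB lx0 (normr_ge0 C2) scl).
Qed.
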